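(* Let $\mathbb{F}$ be a field and let $R$ and $S$ be $\mathbb{F}$-algebras that are differentially smooth with respect to differential calculi $(\Omega R,d_R)$ and $(\Omega S,d_S)$, respectively, such that $\Omega R$ is finitely generated projective as a right $R$-module and $\Omega S$ is finitely generated projective as a right $S$-module. If $$\mathrm{GKdim}(R\otimes S)=\mathrm{GKdim}(R)+\mathrm{GKdim}(S),$$ then the tensor product algebra $R\otimes S$ (over $\mathbb{F}$) is differentially smooth.
   Context: All algebras are associative unital algebras over a field $\mathbb{F}$, and $\otimes=\otimes_{\mathbb F}$. Differential calculus. A differential calculus over an algebra $R$ is a differential graded algebra $(\Omega R,d)$, i.e. a graded algebra with a linear map $d$ of degree $1$ satisfying $d^2=0$ and the graded Leibniz rule $d(\omega\nu)=d(\omega)\nu+(-1)^{|\omega|}\omega d(\nu)$, such that $\Omega R=\bigoplus_{n\in\mathbb{N}}\Omega^nR$ with $\Omega^0R=R$, and $\Omega^nR = R\,d(R)d(R)\cdots d(R)$ ($n$ factors $d(R)$) for all $n\in\mathbb N$ (density condition). It is connected if $\ker(d|_R)=\mathbb{F}$. It is $N$-dimensional if $\Omega^NR\neq 0$ and $\Omega^nR=0$ for all $n>N$. Volume forms and integrability. A volume form of an $N$-dimensional calculus is an element $\mathsf v\in\Omega^NR$ that is a free generator of $\Omega^NR$ both as a left and as a right $R$-module. Its co-ordinate isomorphism is the right $R$-module map $\pi_{\mathsf v}:\Omega^NR\to R$, $\pi_{\mathsf v}(\mathsf v r)=r$. For $k\in\{0,1,\dots,N\}$ set $\ell^k_{\mathsf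 v}:\Omega^kR\to\mathrm{Hom}_R(\Omega^{N-k}R,R)$ (right $R$-linear maps), $\ell^k_{\mathsf v}(\gamma)(\gamma')=\pi_{\mathsf v}(\gamma\gamma')$. An $N$-dimensional differential calculus with a volume form $\mathsf v$ is integrable if all maps $\ell^k_{\mathsf v}$, $0\le k\le N$, are bijective. Differential smoothness. $\mathrm{GKdim}$ denotes the Gelfand-Kirillov dimension. An affine (i.e. finitely generated) algebra $R$ of integer Gelfand-Kirillov dimension $N$ is differentially smooth if there exists a connected, $N$-dimensional, integrable differential calculus on $R$; it is differentially smooth with respect to $(\Omega R,d)$ if $(\Omega R,d)$ is such a calculus. *)

(* Defs.v *)
From HB Require Import structures.
From mathcomp Require Import all_boot all_order all_algebra.
From mathcomp Require Import all_classical all_reals all_analysis.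
From mathcomp Require Import generic_quotient.

Set Implicit Arguments.
Unset Strict Implicit.
Unset Printing Implicit Defensive.

Import Order.TTheory GRing.Theory Num.Theory.
Local Open Scope classical_set_scope.
Local Open Scope ring_scope.
Local Open Scope quotient_scope.

Section LinearAlgebra.
Variables (A : nzRingType) (M : lmodType A).

Definition lin_span (X : set M) : set M :=
  [set x | exists n (c : 'I_n -> A) (e : 'I_n -> M),
     (forall i, X (e i)) /\ x = \sum_(i < n) c i *: e i].

Definition finitely_generated : Prop :=
  exists n (e : 'I_n -> M), lin_span (range e) = [set: M].

Definition projective : Prop :=
  forall (X Y : lmodType A) (g : {linear X -> Y}) (f : {linear M -> Y}),
    (forall y, exists x, g x = y) ->
    exists h : {linear M -> X}, forall m, g (h m) = f m.

Definition linearly_independent n (e : 'I_n -> M) : Prop :=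
  forall c : 'I_n -> A, \sum_(i < n) c i *: e i = 0 -> forall i, c i = 0.

Definition has_dim (U : set M) (n : nat) : Prop :=
  exists e : 'I_n -> M, linearly_independent e /\ lin_span (range e) = U.

(* 0 when U is not a finite-dimensional subspace *)
Definition fin_dim (U : set M) : nat := xget 0%N [set n | has_dim U n].

End LinearAlgebra.

Section GelfandKirillov.
Variables (K : realType) (F : fieldType) (A : algType F).

Definition affine : Prop :=
  exists n (e : 'I_n -> A),
    lin_span [set x | exists m (w : 'I_m -> 'I_n), x = \prod_(i < m) e (w i)]
    = [set: A].

(* F + V + V^2 + ... + V^n, for a subspace V *)
Definition power_sum (V : set A) (n : nat) : set A :=
  lin_span [set x | exists m (w : 'I_m -> A),
    [/\ (m <= n)%N, forall i, V (w i) & x = \prod_(i < m) w i]].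

(* sup over the finite-dimensional subspaces V of
   limsup_n log (dim (F + V + ... + V^n)) / log n *)
Definition GKdim : \bar K :=
  ereal_sup
    [set limn_esup (fun n => (ln (fin_dim (power_sum V n))%:R / ln n%:R)%:E)
    | V in [set V : set A | exists n, has_dim V n]].

End GelfandKirillov.

Section Functional.
Variables (F : fieldType) (U : lmodType F) (u : U).

Lemma exists_functional : u != 0 ->
  exists f : U -> F, linear_for *%R f /\ f u = 1.
Proof.
move=> u0.
pose P (A : set U) :=
  (forall (a : F) x y, A x -> A y -> A (a *: x + y)) /\ ~ A u.
have [|A [[Alin Au] Amax]] := @Zorn_bigcup _ P.
  move=> C CP Ctot; split=> [a x y [X CX Xx] [Y CY Yy]|[X CX Xu]].
    have [XY|YX] := Ctot _ _ CX CY.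
      by exists Y => //; apply: (CP _ CY).1 => //; apply: XY.
    by exists X => //; apply: (CP _ CX).1 => //; apply: YX.
  exact: (CP _ CX).2 Xu.
have {}Amax B z : A `<=` B -> B z -> ~ A z -> ~ P B.
  by move=> AB Bz Az; apply: Amax; split=> // /(_ _ Bz).
have A0 : A 0.
  have [[x Ax]|Ane] := pselect (exists x, A x).
    by have := Alin (-1) _ _ Ax Ax; rewrite scaleN1r addNr.
  have P0 : P [set 0].
    split=> [a x y /= -> ->|/= u00]; first by rewrite scaler0 addr0.
    by rewrite u00 eqxx in u0.
  case: (Amax [set 0] 0) => //; first by move=> x Ax; case: Ane; exists x.
  by move=> A0; apply: Ane; exists 0.
have AZ a x : A x -> A (a *: x) by move=> Ax; have := Alin a _ _ Ax A0; rewrite addr0.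
have AD x y : A x -> A y -> A (x + y) by move=> Ax Ay; have := Alin 1 _ _ Ax Ay; rewrite scale1r.
have dec x : exists c, A (x - c *: u).
  apply: contrapT => nx.
  have PB : P [set z | exists t, A (z - t *: x)].
    split=> [a y z [t At] [t' At']|[t At]].
      exists (a * t + t'); rewrite scalerDl -scalerA opprD addrACA -scalerBr.
      exact: Alin.
    have [t0|t0] := eqVneq t 0; first by move: At; rewrite t0 scale0r subr0.
    apply: nx; exists t^-1.
    have -> : x - t^-1 *: u = - t^-1 *: (u - t *: x).
      by rewrite scalerBr !scaleNr scalerA mulVf// scale1r opprK addrC.
    exact: AZ.
  apply: (Amax _ x _ _ _ PB) => [z Az||].
  - by exists 0; rewrite scale0r subr0.
  - by exists 1; rewrite scale1r subrr.
  - by move=> Ax; apply: nx; exists 0; rewrite scale0r subr0.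
have uniq x c c' : A (x - c *: u) -> A (x - c' *: u) -> c = c'.
  move=> Ac Ac'; apply/eqP; rewrite -subr_eq0; apply/eqP.
  apply: contrapT => /eqP cc'; apply: Au.
  have -> : u = (c - c')^-1 *: ((-1) *: (x - c *: u) + (x - c' *: u)).
    have -> : (-1) *: (x - c *: u) + (x - c' *: u) = (c - c') *: u.
      by rewrite scaleN1r opprB addrA addrNK scalerBl.
    by rewrite scalerA mulVf// scale1r.
  exact/AZ/Alin.
have [f fP] := choice dec.
exists f; split=> [a x y|]; last first.
  by apply: (uniq u) => //; rewrite scale1r subrr.
apply: (uniq (a *: x + y)) => //.
rewrite scalerDl -scalerA opprD addrACA -scalerBr; exact: Alin.
Qed.

End Functional.

Section TensorDef.
Variables (F : fieldType) (U W : lmodType F).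

Notation bilin b := (bilinear_for *:%R *:%R b).

Definition tensor_eval (V : lmodType F) (b : U -> W -> V) (s : seq (U * W)) : V :=
  \sum_(p <- s) b p.1 p.2.

(* A list [:: (u1, w1); ..; (un, wn)] stands for u1 (x) w1 + ... + un (x) wn;
   two such formal sums are identified when no bilinear map separates them,
   i.e. when the bilinearity relations force them to be equal.  The universal
   property is tensor_lift_tens, tensor_lift_linear and tensor_lift_unique. *)
Definition tensor_rel (s t : seq (U * W)) : bool :=
  `[< forall (V : lmodType F) (b : U -> W -> V),
        bilin b -> tensor_eval b s = tensor_eval b t >].

Lemma tensor_rel_refl : reflexive tensor_rel.
Proof. by move=> s; apply/asboolP. Qed.

Lemma tensor_rel_sym : symmetric tensor_rel.
Proof.
by move=> s t; apply/asboolP/asboolP => st V b hb; rewrite (st _ _ hb).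
Qed.

Lemma tensor_rel_trans : transitive tensor_rel.
Proof.
move=> t s r /asboolP st /asboolP tr; apply/asboolP => V b hb.
by rewrite (st _ _ hb) (tr _ _ hb).
Qed.

Canonical tensor_equiv :=
  EquivRel tensor_rel tensor_rel_refl tensor_rel_sym tensor_rel_trans.

Definition tensor := {eq_quot tensor_equiv}.
HB.instance Definition _ := Choice.on tensor.
HB.instance Definition _ := Quotient.on tensor.
HB.instance Definition _ := EqQuotient.on tensor.

Definition tensor_class (s : seq (U * W)) : tensor := \pi s.

Lemma tensor_classP s t : tensor_class s = tensor_class t <-> tensor_rel s t.
Proof. by split=> [/eqquotP|st] //; apply/eqquotP. Qed.

Lemma tensor_classK (x : tensor) : tensor_class (repr x) = x.
Proof. exact: reprK. Qed.

Definition tensor_lift (V : lmodType F) (b : U -> W -> V) (x : tensor) : V :=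
  tensor_eval b (repr x).

Lemma tensor_lift_pi (V : lmodType F) (b : U -> W -> V) s :
  bilin b -> tensor_lift b (tensor_class s) = tensor_eval b s.
Proof.
move=> hb; have /asboolP/(_ _ _ hb) // : tensor_rel (repr (tensor_class s)) s.
by apply/tensor_classP; exact: tensor_classK.
Qed.

Lemma tensor_ext (x y : tensor) :
  (forall (V : lmodType F) (b : U -> W -> V), bilin b ->
     tensor_lift b x = tensor_lift b y) -> x = y.
Proof.
move=> xy; rewrite -[x]tensor_classK -[y]tensor_classK; apply/tensor_classP/asboolP => V b hb.
exact: xy.
Qed.

Lemma tensor_eval_cat (V : lmodType F) (b : U -> W -> V) s t :
  tensor_eval b (s ++ t) = tensor_eval b s + tensor_eval b t.
Proof. exact: big_cat. Qed.

Definition scale_pairs (a : F) (s : seq (U * W)) := [seq (a *: p.1, p.2) | p <- s].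

Lemma bilinZl (V : lmodType F) (b : U -> W -> V) a u w :
  bilin b -> b (a *: u) w = a *: b u w.
Proof. by case=> hl _; exact: (scalable_linear (hl w)). Qed.

Lemma bilinZr (V : lmodType F) (b : U -> W -> V) a u w :
  bilin b -> b u (a *: w) = a *: b u w.
Proof. by case=> _ hr; exact: (scalable_linear (hr u)). Qed.

Lemma tensor_eval_scale (V : lmodType F) (b : U -> W -> V) a s :
  bilin b -> tensor_eval b (scale_pairs a s) = a *: tensor_eval b s.
Proof.
move=> hb; rewrite /tensor_eval big_map scaler_sumr.
by apply: eq_bigr => p _; exact: bilinZl.
Qed.

Definition tensor_zero : tensor := tensor_class [::].
Definition tensor_add (x y : tensor) : tensor := tensor_class (repr x ++ repr y).
Definition tensor_scale (a : F) (x : tensor) : tensor :=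
  tensor_class (scale_pairs a (repr x)).
Definition tensor_opp : tensor -> tensor := tensor_scale (-1).

Section Lift.
Variables (V : lmodType F) (b : U -> W -> V) (hb : bilin b).

Lemma tensor_lift0 : tensor_lift b tensor_zero = 0.
Proof. by rewrite tensor_lift_pi// /tensor_eval big_nil. Qed.

Lemma tensor_liftD x y :
  tensor_lift b (tensor_add x y) = tensor_lift b x + tensor_lift b y.
Proof. by rewrite tensor_lift_pi// tensor_eval_cat. Qed.

Lemma tensor_liftZ a x : tensor_lift b (tensor_scale a x) = a *: tensor_lift b x.
Proof. by rewrite tensor_lift_pi// tensor_eval_scale. Qed.

Lemma tensor_liftN x : tensor_lift b (tensor_opp x) = - tensor_lift b x.
Proof. by rewrite tensor_liftZ scaleN1r. Qed.

End Lift.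

Definition tensor_liftE := (tensor_lift0, tensor_liftD, tensor_liftN, tensor_liftZ).

Lemma tensor_addA : associative tensor_add.
Proof. by move=> x y z; apply: tensor_ext => V b hb; rewrite !tensor_liftE// addrA. Qed.

Lemma tensor_addC : commutative tensor_add.
Proof. by move=> x y; apply: tensor_ext => V b hb; rewrite !tensor_liftE// addrC. Qed.

Lemma tensor_add0 : left_id tensor_zero tensor_add.
Proof. by move=> x; apply: tensor_ext => V b hb; rewrite !tensor_liftE// add0r. Qed.

Lemma tensor_addN : left_inverse tensor_zero tensor_opp tensor_add.
Proof. by move=> x; apply: tensor_ext => V b hb; rewrite !tensor_liftE// addNr. Qed.

HB.instance Definition _ :=
  GRing.isZmodule.Build tensor tensor_addA tensor_addC tensor_add0 tensor_addN.

Lemma tensor_scaleA a b x :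
  tensor_scale a (tensor_scale b x) = tensor_scale (a * b) x.
Proof. by apply: tensor_ext => V f hf; rewrite !tensor_liftE// scalerA. Qed.

Lemma tensor_scale1 : left_id 1 tensor_scale.
Proof. by move=> x; apply: tensor_ext => V f hf; rewrite !tensor_liftE// scale1r. Qed.

Lemma tensor_scaleDr : right_distributive tensor_scale +%R.
Proof. by move=> a x y; apply: tensor_ext => V f hf; rewrite !tensor_liftE// scalerDr. Qed.

Lemma tensor_scaleDl x : {morph tensor_scale^~ x : a b / a + b}.
Proof. by move=> a b; apply: tensor_ext => V f hf; rewrite !tensor_liftE// scalerDl. Qed.

HB.instance Definition _ := GRing.Zmodule_isLmodule.Build F tensor
  tensor_scaleA tensor_scale1 tensor_scaleDr tensor_scaleDl.

Definition tens (u : U) (w : W) : tensor := tensor_class [:: (u, w)].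

Lemma tensor_lift_tens (V : lmodType F) (b : U -> W -> V) u w :
  bilin b -> tensor_lift b (tens u w) = b u w.
Proof. by move=> hb; rewrite tensor_lift_pi// /tensor_eval big_seq1. Qed.

Lemma tensor_lift_linear (V : lmodType F) (b : U -> W -> V) :
  bilin b -> linear (tensor_lift b).
Proof. by move=> hb a x y; rewrite tensor_liftD// tensor_liftZ. Qed.

Lemma tens_bilinear : bilin tens.
Proof.
split=> [w a u u'|u a w w']; apply: tensor_ext => V b hb;
  rewrite tensor_liftD// tensor_liftZ// !tensor_lift_tens//.
  by rewrite (hb.1 w).
by rewrite (hb.2 u).
Qed.

Lemma tensor_sum (x : tensor) : x = \sum_(p <- repr x) tens p.1 p.2.
Proof.
rewrite -[LHS]tensor_classK; elim: (repr x) => [|[u w] s ihs]; first by rewrite big_nil.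
rewrite big_cons -ihs; apply: tensor_ext => V b hb.
rewrite tensor_liftD// tensor_lift_tens// !tensor_lift_pi//.
by rewrite /tensor_eval big_cons.
Qed.

Lemma tensor_lift_unique (V : lmodType F) (b : U -> W -> V) (f : {linear tensor -> V}) :
  (forall u w, f (tens u w) = b u w) -> f =1 tensor_lift b.
Proof.
move=> fb x; rewrite [in LHS](tensor_sum x) linear_sum /tensor_lift /tensor_eval.
by apply: eq_bigr => p _.
Qed.

End TensorDef.

Section TensorAlgebra.
Variables (F : fieldType) (R S : algType F).
Notation T := (tensor R S).
Notation bilin b := (bilinear_for *:%R *:%R b).

Definition mul_pairs (s t : seq (R * S)) : seq (R * S) :=
  [seq (p.1 * q.1, p.2 * q.2) | p <- s, q <- t].

Definition tensor_one : T := tens 1 1.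

(* (r (x) s) (r' (x) s') = r r' (x) s s', extended biadditively *)
Definition tensor_mul (x y : T) : T := tensor_class (mul_pairs (repr x) (repr y)).

Lemma bilin_mull (V : lmodType F) (b : R -> S -> V) r s :
  bilin b -> bilin (fun r' s' => b (r * r') (s * s')).
Proof.
move=> hb; split=> [y a x x'|x a y y'] /=; rewrite mulrDr -scalerAr.
  exact: hb.1.
exact: hb.2.
Qed.

Lemma bilin_mulr (V : lmodType F) (b : R -> S -> V) r s :
  bilin b -> bilin (fun r' s' => b (r' * r) (s' * s)).
Proof.
move=> hb; split=> [y a x x'|x a y y'] /=; rewrite mulrDl -scalerAl.
  exact: hb.1.
exact: hb.2.
Qed.

Lemma bilin_sum (V : lmodType F) (I : Type) (l : seq I) (b : I -> R -> S -> V) :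
  (forall i, bilin (b i)) -> bilin (fun r s => \sum_(i <- l) b i r s).
Proof.
move=> hb; split=> [y a x x'|x a y y'] /=; rewrite scaler_sumr -big_split /=;
  apply: eq_bigr => i _.
  exact: (hb i).1.
exact: (hb i).2.
Qed.

Lemma tensor_lift_mul (V : lmodType F) (b : R -> S -> V) x y : bilin b ->
  tensor_lift b (tensor_mul x y) =
  tensor_lift (fun r s => tensor_lift (fun r' s' => b (r * r') (s * s')) y) x.
Proof.
move=> hb; rewrite tensor_lift_pi// /tensor_eval /mul_pairs big_allpairs_dep /=.
by rewrite [RHS]/tensor_lift /tensor_eval; apply: eq_bigr => p _.
Qed.

Lemma bilin_lift_mul (V : lmodType F) (b : R -> S -> V) y : bilin b ->
  bilin (fun r s => tensor_lift (fun r' s' => b (r * r') (s * s')) y).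
Proof. by move=> hb; apply: bilin_sum => p; exact: bilin_mulr. Qed.

Lemma tensor_mulA : associative tensor_mul.
Proof.
move=> x y z; apply: tensor_ext => V b hb.
rewrite !tensor_lift_mul//; last exact: bilin_lift_mul.
apply: eq_bigr => p _; rewrite tensor_lift_mul; last exact: bilin_mull.
apply: eq_bigr => q _; apply: eq_bigr => t _.
by rewrite !mulrA.
Qed.

Lemma tensor_mul1l : left_id tensor_one tensor_mul.
Proof.
move=> x; apply: tensor_ext => V b hb.
rewrite tensor_lift_mul// tensor_lift_tens; last exact: bilin_lift_mul.
by apply: eq_bigr => p _; rewrite !mul1r.
Qed.

Lemma tensor_mul1r : right_id tensor_one tensor_mul.
Proof.
move=> x; apply: tensor_ext => V b hb.
rewrite tensor_lift_mul//; apply: eq_bigr => p _.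
by rewrite tensor_lift_tens ?mulr1//; exact: bilin_mull.
Qed.

Lemma tensor_mulDl : left_distributive tensor_mul +%R.
Proof.
move=> x y z; apply: tensor_ext => V b hb.
by rewrite tensor_liftD// !tensor_lift_mul// tensor_liftD//; exact: bilin_lift_mul.
Qed.

Lemma tensor_mulDr : right_distributive tensor_mul +%R.
Proof.
move=> x y z; apply: tensor_ext => V b hb.
rewrite tensor_liftD// !tensor_lift_mul// /tensor_lift /tensor_eval -big_split /=.
by apply: eq_bigr => p _; exact: (tensor_liftD (bilin_mull p.1 p.2 hb) y z).
Qed.

Lemma tensor_one_neq0 : tensor_one != 0.
Proof.
have [f [flin f1]] := exists_functional (oner_neq0 R).
have [g [glin g1]] := exists_functional (oner_neq0 S).
pose b (r : R) (s : S) : F^o := f r * g s.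
have hb : bilin b.
  split=> [s a r r'|r a s s']; rewrite /b /=.
    by rewrite flin mulrDl -mulrA.
  by rewrite glin mulrDr mulrCA.
apply/eqP => /(congr1 (tensor_lift b)).
rewrite tensor_lift_tens// [RHS]tensor_lift0// /b f1 g1 mulr1.
by apply/eqP; exact: oner_neq0.
Qed.

HB.instance Definition _ := GRing.Zmodule_isNzRing.Build T
  tensor_mulA tensor_mul1l tensor_mul1r tensor_mulDl tensor_mulDr
  tensor_one_neq0.

Lemma tensor_scaleAl (a : F) (x y : T) : a *: (x * y) = (a *: x) * y.
Proof.
apply: tensor_ext => V b hb; rewrite tensor_liftZ// !tensor_lift_mul//.
by rewrite tensor_liftZ//; exact: bilin_lift_mul.
Qed.

HB.instance Definition _ := GRing.LSemiModule_isLSemiAlgebra.Build F T tensor_scaleAl.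

Lemma tensor_scaleAr (a : F) (x y : T) : a *: (x * y) = x * (a *: y).
Proof.
apply: tensor_ext => V b hb; rewrite tensor_liftZ// !tensor_lift_mul//.
rewrite /tensor_lift /tensor_eval scaler_sumr; apply: eq_bigr => p _.
by rewrite -(tensor_liftZ (bilin_mull p.1 p.2 hb) a y).
Qed.

HB.instance Definition _ := GRing.Lalgebra_isAlgebra.Build F T tensor_scaleAr.

Lemma tensM r s r' s' : tens r s * tens r' s' = tens (r * r') (s * s') :> T.
Proof.
apply: tensor_ext => V b hb; rewrite tensor_lift_mul//.
rewrite tensor_lift_tens; last exact: bilin_lift_mul.
by rewrite !tensor_lift_tens//; exact: bilin_mull.
Qed.

End TensorAlgebra.

Section Calculus.
Variables (F : fieldType) (R : algType F).

Definition graded_algebra (A : algType F) (G : nat -> set A) : Prop :=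
  [/\ (forall n, G n 0 /\ forall (a : F) x y, G n x -> G n y -> G n (a *: x + y)),
      G 0%N 1 /\ (forall m n x y, G m x -> G n y -> G (m + n)%N (x * y)),
      (forall x, exists n (f : nat -> A),
         (forall i, G i (f i)) /\ x = \sum_(i < n) f i) &
      (forall n (f : nat -> A), (forall i, G i (f i)) ->
         \sum_(i < n) f i = 0 -> forall i, (i < n)%N -> f i = 0)].

(* calc_inj identifies R with the degree 0 part of Omega R *)
Record calculus := Calculus {
  calc_alg : algType F;
  calc_deg : nat -> set calc_alg;
  calc_inj : {lrmorphism R -> calc_alg};
  calc_d : {linear calc_alg -> calc_alg};
  calc_graded : graded_algebra calc_deg;
  calc_injective : injective calc_inj;
  calc_deg0 : calc_deg 0 = range calc_inj;
  calc_d_deg : forall n w, calc_deg n w -> calc_deg n.+1 (calc_d w);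
  calc_dd : forall w, calc_d (calc_d w) = 0;
  calc_leibniz : forall n w v, calc_deg n w ->
    calc_d (w * v) = calc_d w * v + (-1) ^+ n * w * calc_d v;
  calc_dense : forall n, calc_deg n =
    lin_span [set w | exists (r : R) (s : 'I_n -> R),
            w = calc_inj r * \prod_(i < n) calc_d (calc_inj (s i))]
}.

Section OneCalculus.
Variable C : calculus.
Notation inj := (calc_inj C).
Notation Om := (@calc_deg C).

Definition connected_calculus : Prop :=
  forall r : R, calc_d C (inj r) = 0 <-> exists a : F, r = a%:A.

Definition calculus_dimension (N : nat) : Prop :=
  Om N <> [set 0] /\ forall n, (N < n)%N -> Om n = [set 0].

Definition volume_form (N : nat) (v : calc_alg C) : Prop :=
  [/\ Om N v,
      set_bij [set: R] (Om N) (fun r => inj r * v) &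
      set_bij [set: R] (Om N) (fun r => v * inj r)].

(* the co-ordinate map pi_v; the value 0 outside Omega^N is irrelevant *)
Definition coordinate (v w : calc_alg C) : R := xget 0 [set r | v * inj r = w].

Definition right_hom (m : nat) : set (Om m -> R) :=
  [set f | forall (r : R) (x y z : Om m),
     val z = val x * inj r + val y -> f z = f x * r + f y].

Definition ell (N : nat) (v : calc_alg C) (k : nat) (g : Om k) (g' : Om (N - k)%N) : R :=
  coordinate v (val g * val g').

Definition integrable_calculus (N : nat) (v : calc_alg C) : Prop :=
  forall k, (k <= N)%N ->
    set_bij [set: Om k] (@right_hom (N - k)%N) (@ell N v k).

(* Omega R as a right R-module, i.e. a left module over the opposite ring *)
Definition right_module : Type := calc_alg C.
HB.instance Definition _ := GRing.Zmodule.on right_module.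

Definition right_scale (r : R^c) (w : right_module) : right_module :=
  (w : calc_alg C) * inj r.

Lemma right_scaleA a b w :
  right_scale a (right_scale b w) = right_scale (a * b) w.
Proof. by rewrite /right_scale -mulrA -rmorphM. Qed.

Lemma right_scale1 : left_id 1 right_scale.
Proof. by move=> w; rewrite /right_scale rmorph1 mulr1. Qed.

Lemma right_scaleDr : right_distributive right_scale +%R.
Proof. by move=> a x y; rewrite /right_scale mulrDl. Qed.

Lemma right_scaleDl w : {morph right_scale^~ w : a b / a + b}.
Proof. by move=> a b; rewrite /right_scale raddfD mulrDr. Qed.

HB.instance Definition _ := GRing.Zmodule_isLmodule.Build R^c right_module
  right_scaleA right_scale1 right_scaleDr right_scaleDl.

Definition fg_projective_right : Prop :=
  finitely_generated right_module /\ projective right_module.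

Definition differentially_smooth_wrt (K : realType) : Prop :=
  affine R /\
  exists N : nat,
    [/\ GKdim K R = N%:R%:E,
        connected_calculus,
        calculus_dimension N &
        exists2 v, volume_form N v & integrable_calculus N v].

End OneCalculus.

Definition differentially_smooth (K : realType) : Prop :=
  exists C : calculus, differentially_smooth_wrt C K.

End Calculus.

(* Main.v *)
Require Import Defs.
From HB Require Import structures.
From mathcomp Require Import all_boot all_order all_algebra.
From mathcomp Require Import all_classical all_reals all_analysis.

(** The tensor product of the two calculi is [Omega R (x) Omega S] with the
    product [(a (x) b) (a' (x) b') = (-1) ^ (|b| |a'|) a a' (x) b b'], the
    differential [d (a (x) b) = d a (x) b + (-1) ^ |a| a (x) d b] and the total
    degree ([tensor_calculus]).  Its dimension is the sum [N + M] of the two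
    dimensions, hence the Gelfand-Kirillov dimension of [R (x) S] by hypothesis,
    and [v (x) v'] is a volume form when [v] and [v'] are
    ([dimension_tensor], [volume_form_tensor]).

    Over a field, the kernel of a tensor product of linear maps is controlled by
    the kernels of the factors, even for families of maps ([tmap_ker]).  This
    gives the injectivity of the inclusion of [R (x) S], the freeness of
    [v (x) v'], the connectedness ([connected_tensor]) and the nondegeneracy of
    the pairings [(g, g') |-> g g'] with values in the top degree
    ([perfect_tensor_inj]).  For the latter, multiplication by [w (x) w'] of
    bidegree [(N - i, M - j)] sees, in the top bidegree, only the component of
    bidegree [(i, j)].

    That the pairings represent every right linear form is checked one bidegree
    at a time ([perfect_tensor_bideg]).  As [Omega R] and [Omega S] are finitely
    generated and projective, they have dual bases ([dual_basis]); these write a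
    right linear form on [Omega^p R (x) Omega^q S] as a finite sum of terms
    [w (x) w' |-> r h w (x) s h' w'], where [h] and [h'] are right linear.
    Integrability of the factors represents [w |-> r h w] and [w' |-> s h' w']
    by left multiplications by some [a] and [b], and then [a (x) b] represents
    the term, up to a sign. *)

Set Implicit Arguments.
Unset Strict Implicit.
Unset Printing Implicit Defensive.

Import GRing.Theory.
Local Open Scope classical_set_scope.
Local Open Scope ring_scope.

(** * Linear spans *)

Section LinSpan.
Variables (A : nzRingType) (M : lmodType A).
Implicit Types X Y : set M.

Lemma lin_span_gen X x : X x -> lin_span X x.
Proof.
move=> Xx; exists 1%N, (fun=> 1), (fun=> x).
by split=> //; rewrite big_ord1 scale1r.
Qed.

Lemma lin_span0 X : lin_span X 0.
Proof.
by exists 0%N, (fun=> 0), (fun=> 0); split=> [[]//|]; rewrite big_ord0.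
Qed.

Lemma lin_spanD X x y : lin_span X x -> lin_span X y -> lin_span X (x + y).
Proof.
move=> [n [c [e [Xe ->]]]] [m [c' [e' [Xe' ->]]]].
exists (n + m)%N, (fun i => match fintype.split i with inl j => c j | inr j => c' j end),
  (fun i => match fintype.split i with inl j => e j | inr j => e' j end).
split=> [i|]; first by case: fintype.split.
rewrite big_split_ord /=; congr (_ + _); apply: eq_bigr => i _.
  by rewrite (unsplitK (inl _ i)).
by rewrite (unsplitK (inr _ i)).
Qed.

Lemma lin_spanZ X a x : lin_span X x -> lin_span X (a *: x).
Proof.
move=> [n [c [e [Xe ->]]]]; exists n, (fun i => a * c i), e; split=> //.
by rewrite scaler_sumr; apply: eq_bigr => i _; rewrite scalerA.
Qed.

Lemma lin_span_min X (P : M -> Prop) :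
  P 0 -> (forall x y, P x -> P y -> P (x + y)) ->
  (forall a x, P x -> P (a *: x)) -> (forall x, X x -> P x) ->
  forall x, lin_span X x -> P x.
Proof.
move=> P0 PD PZ XP x [n [c [e [Xe ->]]]].
by apply: (big_ind P) => // i _; apply: PZ; apply: XP; apply: Xe.
Qed.

End LinSpan.

(** * Tensor products of linear maps *)

Section TensorMap.
Variable F : fieldType.
Notation bilin b := (bilinear_for *:%R *:%R b).

Lemma tensDl (U W : lmodType F) (u u' : U) (w : W) :
  tens (u + u') w = tens u w + tens u' w.
Proof. by have /= := (tens_bilinear U W).1 w 1 u u'; rewrite !scale1r. Qed.

Lemma tensDr (U W : lmodType F) (u : U) (w w' : W) :
  tens u (w + w') = tens u w + tens u w'.
Proof. by have /= := (tens_bilinear U W).2 u 1 w w'; rewrite !scale1r. Qed.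

Lemma tensZl (U W : lmodType F) a (u : U) (w : W) :
  tens (a *: u) w = a *: tens u w.
Proof. exact: (bilinZl a u w (tens_bilinear U W)). Qed.

Lemma tensZr (U W : lmodType F) a (u : U) (w : W) :
  tens u (a *: w) = a *: tens u w.
Proof. exact: (bilinZr a u w (tens_bilinear U W)). Qed.

Lemma tens0l (U W : lmodType F) (w : W) : tens (0 : U) w = 0.
Proof. by rewrite -(scale0r 0) tensZl scale0r. Qed.

Lemma tens0r (U W : lmodType F) (u : U) : tens u (0 : W) = 0.
Proof. by rewrite -(scale0r 0) tensZr scale0r. Qed.

Lemma tens_suml (U W : lmodType F) I (r : seq I) (P : pred I) (f : I -> U) (w : W) :
  tens (\sum_(i <- r | P i) f i) w = \sum_(i <- r | P i) tens (f i) w.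
Proof. by rewrite (big_morph _ (fun x y => tensDl x y w) (tens0l _ w)). Qed.

Lemma tens_sumr (U W : lmodType F) I (r : seq I) (P : pred I) (f : I -> W) (u : U) :
  tens u (\sum_(i <- r | P i) f i) = \sum_(i <- r | P i) tens u (f i).
Proof. by rewrite (big_morph _ (tensDr u) (tens0r _ u)). Qed.

Lemma tensor_ind (U W : lmodType F) (P : tensor U W -> Prop) :
  P 0 -> (forall x y, P x -> P y -> P (x + y)) -> (forall u w, P (tens u w)) ->
  forall x, P x.
Proof.
by move=> P0 PD Pt x; rewrite (tensor_sum x); apply: (big_ind P).
Qed.

Section Map.
Variables (U W U' W' : lmodType F) (f : {linear U -> U'}) (g : {linear W -> W'}).

Lemma tmap_bilinear : bilin (fun u w => tens (f u) (g w)).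
Proof.
by split=> [w a u u'|u a w w'] /=; rewrite linearP ?tensDl ?tensDr ?tensZl ?tensZr.
Qed.

(** The tensor product of two linear maps. *)
Definition tmap : tensor U W -> tensor U' W' :=
  tensor_lift (fun u w => tens (f u) (g w)).

Lemma tmap_linear : linear tmap.
Proof. exact: tensor_lift_linear tmap_bilinear. Qed.

HB.instance Definition _ := GRing.isLinear.Build F (tensor U W) (tensor U' W')
  *:%R tmap tmap_linear.

Lemma tmapE u w : tmap (tens u w) = tens (f u) (g w).
Proof. exact: tensor_lift_tens tmap_bilinear. Qed.

End Map.

Section Contraction.
Variables (U W : lmodType F).

Lemma contractr_bilinear (g : {linear W -> F^o}) :
  bilin (fun (u : U) w => (g w : F) *: u).
Proof.
split=> [w a u u'|u a w w'] /=; first by rewrite scalerDr !scalerA mulrC.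
by rewrite linearP scalerDl scalerA.
Qed.

(** The contraction [1 (x) g] of the right factor with a linear form. *)
Definition contractr (g : {linear W -> F^o}) : tensor U W -> U :=
  tensor_lift (fun u w => (g w : F) *: u).

HB.instance Definition _ g := GRing.isLinear.Build F (tensor U W) U
  *:%R (contractr g) (tensor_lift_linear (contractr_bilinear g)).

Lemma contractrE g u w : contractr g (tens u w) = (g w : F) *: u.
Proof. exact: tensor_lift_tens (contractr_bilinear g). Qed.

Lemma contractl_bilinear (f : {linear U -> F^o}) :
  bilin (fun u (w : W) => (f u : F) *: w).
Proof.
split=> [w a u u'|u a w w'] /=; first by rewrite linearP scalerDl scalerA.
by rewrite scalerDr !scalerA mulrC.
Qed.

(** The contraction [f (x) 1] of the left factor with a linear form. *)
Definition contractl (f : {linear U -> F^o}) : tensor U W -> W :=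
  tensor_lift (fun u w => (f u : F) *: w).

HB.instance Definition _ f := GRing.isLinear.Build F (tensor U W) W
  *:%R (contractl f) (tensor_lift_linear (contractl_bilinear f)).

Lemma contractlE f u w : contractl f (tens u w) = (f u : F) *: w.
Proof. exact: tensor_lift_tens (contractl_bilinear f). Qed.

End Contraction.

Lemma exists_linear_form (U : lmodType F) (u : U) : u != 0 ->
  exists f : {linear U -> F^o}, f u = 1.
Proof.
move=> /exists_functional[f [flin fu]].
pose mf := GRing.isLinear.Build F U F^o *:%R f flin.
by exists (HB.pack f mf : {linear U -> F^o}).
Qed.

(** Finitely many vectors are fixed by some linear map of finite rank.  To make
    such a map [p] also fix [u], when [u - p u != 0], add to it the form
    [f \o (1 - p)] times the vector [u - p u], where [f (u - p u) = 1]. *)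
Lemma finite_coordinates (U : lmodType F) (s : seq U) :
  exists n (e : 'I_n -> U) (f : 'I_n -> {linear U -> F^o}),
    forall u, u \in s -> u = \sum_(i < n) (f i u : F) *: e i.
Proof.
elim: s => [|u s [n [e [f ef]]]].
  by exists 0%N, (fun=> 0), (fun=> (\0 : {linear U -> F^o})).
pose p (x : U) := \sum_(i < n) (f i x : F) *: e i.
have plin : linear p.
  move=> a x y; rewrite scaler_sumr -big_split /=; apply: eq_bigr => i _.
  by rewrite linearP scalerDl scalerA.
have [pu|pu] := eqVneq (u - p u) 0.
  exists n, e, f => z; rewrite in_cons => /orP[/eqP ->|/ef//].
  exact/subr0_eq.
have [g gu] := exists_linear_form pu.
pose h (x : U) : F^o := g (x - p x).
have hlin : linear h.
  by move=> a x y; rewrite /h plin opprD addrACA -scalerBr linearP.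
pose mh := GRing.isLinear.Build F U F^o *:%R h hlin.
exists n.+1, (fun i => if unlift ord0 i is Some j then e j else u - p u),
  (fun i => if unlift ord0 i is Some j then f j else
            (HB.pack h mh : {linear U -> F^o})) => z zs.
rewrite big_ord_recl unlift_none /=.
under eq_bigr do rewrite liftK.
rewrite -/(p z) /h; move: zs; rewrite in_cons => /orP[/eqP ->|/ef zE].
  by rewrite gu scale1r subrK.
have -> : p z = z by exact/esym.
by rewrite subrr linear0 scale0r add0r.
Qed.

(** Linear forms separate the points of a tensor product: [x] is the sum of the
    [contractr (f i) x (x) e i] for suitable finite families [e] and [f]. *)
Lemma contractr_eq0 (U W : lmodType F) (x : tensor U W) :
  (forall g, contractr g x = 0) -> x = 0.
Proof.
move=> x0; have [n [e [f ef]]] := finite_coordinates [seq p.2 | p <- repr x].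
transitivity (\sum_(i < n) tens (contractr (f i) x) (e i)); last first.
  by rewrite big1// => i _; rewrite x0 tens0l.
have cE i : tens (contractr (f i) x) (e i) =
    \sum_(p <- repr x) tens p.1 ((f i p.2 : F) *: e i).
  rewrite {1}(tensor_sum x) linear_sum tens_suml.
  by apply: eq_bigr => p _ /=; rewrite contractrE tensZl tensZr.
rewrite (eq_bigr _ (fun i _ => cE i)) exchange_big /= {1}(tensor_sum x).
rewrite big_seq [RHS]big_seq; apply: eq_bigr => p px.
by rewrite {1}(ef p.2) ?map_f// tens_sumr.
Qed.

Lemma contractl_eq0 (U W : lmodType F) (x : tensor U W) :
  (forall f, contractl f x = 0) -> x = 0.
Proof.
move=> x0; have [n [e [f ef]]] := finite_coordinates [seq p.1 | p <- repr x].
transitivity (\sum_(i < n) tens (e i) (contractl (f i) x)); last first.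
  by rewrite big1// => i _; rewrite x0 tens0r.
have cE i : tens (e i) (contractl (f i) x) =
    \sum_(p <- repr x) tens ((f i p.1 : F) *: e i) p.2.
  rewrite {1}(tensor_sum x) linear_sum tens_sumr.
  by apply: eq_bigr => p _ /=; rewrite contractlE tensZl tensZr.
rewrite (eq_bigr _ (fun i _ => cE i)) exchange_big /= {1}(tensor_sum x).
rewrite big_seq [RHS]big_seq; apply: eq_bigr => p px.
by rewrite {1}(ef p.1) ?map_f// tens_suml.
Qed.

Lemma tmap_comp (U W U' W' U'' W'' : lmodType F)
    (f : {linear U -> U'}) (g : {linear W -> W'})
    (f' : {linear U' -> U''}) (g' : {linear W' -> W''})
    (f'' : {linear U -> U''}) (g'' : {linear W -> W''}) :
  f' \o f =1 f'' -> g' \o g =1 g'' -> tmap f' g' \o tmap f g =1 tmap f'' g''.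
Proof.
move=> hf hg; elim/tensor_ind => [|x y ihx ihy|u w] /=; first by rewrite !linear0.
  by rewrite !linearD /= -ihx -ihy.
by rewrite !tmapE -hf -hg.
Qed.

Lemma tmap_id (U W : lmodType F) :
  tmap (idfun : {linear U -> U}) (idfun : {linear W -> W}) =1 id.
Proof.
elim/tensor_ind => [|x y ihx ihy|u w]; first by rewrite !linear0.
  by rewrite !linearD /= ihx ihy.
by rewrite !tmapE.
Qed.

Lemma tmap_kerl (I : Type) (U W U' V : lmodType F)
    (f : I -> {linear U -> U'}) (p : {linear U -> V}) (x : tensor U W) :
  (forall u, (forall i, f i u = 0) -> p u = 0) ->
  (forall i, tmap (f i) idfun x = 0) -> tmap p idfun x = 0.
Proof.
move=> fp fx; apply: contractr_eq0 => g.
have cE (V' : lmodType F) (h : {linear U -> V'}) y :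
    contractr g (tmap h idfun y) = h (contractr g y).
  elim/tensor_ind: y => [|y z ihy ihz|u w]; first by rewrite !linear0.
    by rewrite !linearD /= ihy ihz.
  by rewrite tmapE !contractrE linearZ.
by rewrite cE; apply: fp => i; rewrite -cE fx linear0.
Qed.

Lemma tmap_kerr (J : Type) (U W W' V : lmodType F)
    (g : J -> {linear W -> W'}) (q : {linear W -> V}) (x : tensor U W) :
  (forall w, (forall j, g j w = 0) -> q w = 0) ->
  (forall j, tmap idfun (g j) x = 0) -> tmap idfun q x = 0.
Proof.
move=> gq gx; apply: contractl_eq0 => f.
have cE (V' : lmodType F) (h : {linear W -> V'}) y :
    contractl f (tmap idfun h y) = h (contractl f y).
  elim/tensor_ind: y => [|y z ihy ihz|u w]; first by rewrite !linear0.
    by rewrite !linearD /= ihy ihz.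
  by rewrite tmapE !contractlE linearZ.
by rewrite cE; apply: gq => i; rewrite -cE gx linear0.
Qed.

(** Over a field, joint injectivity of families of linear maps passes to tensor
    products: if the common kernel of the [f i] lies in [ker p] and that of the
    [g j] in [ker q], then the common kernel of the [f i (x) g j] lies in
    [ker (p (x) q)]. *)
Lemma tmap_ker (I J : Type) (U W U' W' V V' : lmodType F)
    (f : I -> {linear U -> U'}) (g : J -> {linear W -> W'})
    (p : {linear U -> V}) (q : {linear W -> V'}) (x : tensor U W) :
  (forall u, (forall i, f i u = 0) -> p u = 0) ->
  (forall w, (forall j, g j w = 0) -> q w = 0) ->
  (forall i j, tmap (f i) (g j) x = 0) -> tmap p q x = 0.
Proof.
move=> fp gq fgx.
have -> : tmap p q x = tmap p idfun (tmap idfun q x).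
  by rewrite -(tmap_comp (f' := p) (f := idfun) (g' := idfun) (g := q)).
apply: (tmap_kerl fp) => i.
have -> : tmap (f i) idfun (tmap idfun q x) = tmap idfun q (tmap (f i) idfun x).
  rewrite -[LHS]/((_ \o _) x) -[RHS]/((_ \o _) x).
  by rewrite !(tmap_comp (f'' := f i) (g'' := q)).
apply: (tmap_kerr gq) => j.
rewrite -[LHS]/((_ \o _) x).
by rewrite (tmap_comp (f'' := f i) (g'' := g j)).
Qed.

Lemma tmap_inj (U W U' W' : lmodType F)
    (f : {linear U -> U'}) (g : {linear W -> W'}) :
  injective f -> injective g -> injective (tmap f g).
Proof.
move=> fi gi x y /eqP; rewrite -subr_eq0 -linearB => /eqP fg0.
apply/subr0_eq; rewrite -[LHS]tmap_id.
apply: (tmap_ker (I := unit) (J := unit) (f := fun=> f) (g := fun=> g)) => //.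
  by move=> u /(_ tt) fu; apply: fi; rewrite fu linear0.
by move=> w /(_ tt) gw; apply: gi; rewrite gw linear0.
Qed.

Section KillVector.
Variables (U W : lmodType F) (u : U) (f : {linear U -> F^o}).

(** When [f u = 1], the projection along the line spanned by [u]. *)
Definition kill_vector (x : U) : U := x - (f x : F) *: u.

Lemma kill_vector_linear : linear kill_vector.
Proof.
by move=> k y z; rewrite /kill_vector linearP scalerDl opprD addrACA -scalerA -scalerBr.
Qed.

HB.instance Definition _ := GRing.isLinear.Build F U U *:%R kill_vector kill_vector_linear.

Lemma kill_vectorZ a : f u = 1 -> kill_vector (a *: u) = 0.
Proof.
by move=> f1; rewrite /kill_vector [f _]linearZ /= f1 [_ *: 1 : F^o]mulr1 subrr.
Qed.

Lemma tmap_kill_vectorl (y : tensor U W) :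
  tmap kill_vector idfun y = y - tens u (contractl f y).
Proof.
elim/tensor_ind: y => [|y z ihy ihz|r s].
- by rewrite !linear0 tens0r subr0.
- by rewrite !linearD /= ihy ihz tensDr opprD addrACA.
- by rewrite tmapE contractlE /= /kill_vector tensDl -scaleNr tensZl tensZr scaleNr.
Qed.

Lemma tmap_kill_vectorr (y : tensor W U) :
  tmap idfun kill_vector y = y - tens (contractr f y) u.
Proof.
elim/tensor_ind: y => [|y z ihy ihz|r s].
- by rewrite !linear0 tens0l subr0.
- by rewrite !linearD /= ihy ihz tensDl opprD addrACA.
- by rewrite tmapE contractrE /= /kill_vector tensDr -scaleNr tensZl tensZr scaleNr.
Qed.

End KillVector.

End TensorMap.

(** * Homogeneous components *)

Section Graded.
Variables (F : fieldType) (A : algType F) (G : nat -> set A).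
Hypothesis hG : graded_algebra G.

Lemma deg0 n : G n 0.
Proof. by case: hG => /(_ n)[]. Qed.

Lemma degP n a x y : G n x -> G n y -> G n (a *: x + y).
Proof. by case: hG => /(_ n)[_ GP] _ _ _; exact: GP. Qed.

Lemma degD n x y : G n x -> G n y -> G n (x + y).
Proof. by move=> Gx Gy; rewrite -(scale1r x); exact: degP. Qed.

Lemma deg_one : G 0 1.
Proof. by case: hG => _ []. Qed.

Lemma degM m n x y : G m x -> G n y -> G (m + n)%N (x * y).
Proof. by case: hG => _ [_ GM] _ _; exact: GM. Qed.

Lemma deg_ind (P : A -> Prop) :
  P 0 -> (forall x y, P x -> P y -> P (x + y)) ->
  (forall n x, G n x -> P x) -> forall x, P x.
Proof.
move=> P0 PD PG x; have [_ _ /(_ x)[n [f [Gf ->]]] _] := hG.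
by apply: (big_ind P) => // i _; exact: PG (Gf i).
Qed.

(** A chosen decomposition into homogeneous elements. *)
Definition deg_decomp x :
    {nf : nat * (nat -> A) | (forall i, G i (nf.2 i)) /\ x = \sum_(i < nf.1) nf.2 i}.
Proof.
by apply: cid; have [_ _ /(_ x)[n [f [Gf xf]]] _] := hG; exists (n, f).
Qed.

(** The linear map that multiplies elements of degree [n] by [c n].  Particular
    weights give the homogeneous components, the even and odd parts and the
    parity involution. *)
Definition weight (c : nat -> F) (x : A) : A :=
  \sum_(i < (sval (deg_decomp x)).1) c i *: (sval (deg_decomp x)).2 i.

Lemma weight_sum c n (f : nat -> A) : (forall i, G i (f i)) ->
  weight c (\sum_(i < n) f i) = \sum_(i < n) c i *: f i.
Proof.
move=> Gf; rewrite /weight; set x := \sum_(i < n) f i.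
case: (deg_decomp x) => -[m g] [/= Gg xg].
have [_ _ _ hU] := hG.
pose t k (h : nat -> A) i := if (i < k)%N then h i else 0.
have tE k (h : nat -> A) l : (k <= l)%N -> \sum_(i < k) h i = \sum_(i < l) t k h i.
  by move=> kl; rewrite (big_ord_widen _ h kl) big_mkcond.
have Gt k h i : (forall i, G i (h i)) -> G i (t k h i).
  by rewrite /t => Gh; case: ifP => // _; exact: deg0.
(* Pad both decompositions of x with zeros up to a common length. *)
pose l := maxn m n.
have ml : (m <= l)%N by exact: leq_maxl.
have nl : (n <= l)%N by exact: leq_maxr.
have tfg i : (i < l)%N -> t m g i = t n f i.
  move=> il; apply/eqP; rewrite -subr_eq0; apply/eqP.
  apply: (hU l (fun i => t m g i - t n f i)) => // [j|].
    by rewrite addrC -scaleN1r; apply: degP; exact: Gt.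
  by rewrite sumrB -!tE// -xg subrr.
have cE k (h : nat -> A) i : t k (fun i => c i *: h i) i = c i *: t k h i.
  by rewrite /t; case: ifP; rewrite ?scaler0.
rewrite (tE _ (fun i => c i *: g i) _ ml) (tE _ (fun i => c i *: f i) _ nl).
by apply: eq_bigr => i _; rewrite !cE tfg.
Qed.

Lemma deg_decomp2 x y : exists n (f g : nat -> A),
  [/\ forall i, G i (f i), forall i, G i (g i),
      x = \sum_(i < n) f i & y = \sum_(i < n) g i].
Proof.
have [_ _ hE _] := hG.
have [n [f [Gf ->]]] := hE x; have [m [g [Gg ->]]] := hE y.
pose t k (h : nat -> A) i := if (i < k)%N then h i else 0.
have Gt k h i : (forall i, G i (h i)) -> G i (t k h i).
  by rewrite /t => Gh; case: ifP => // _; exact: deg0.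
exists (maxn n m), (t n f), (t m g); split=> [i|i||]; try exact: Gt.
  by rewrite (big_ord_widen _ f (leq_maxl n m)) big_mkcond.
by rewrite (big_ord_widen _ g (leq_maxr n m)) big_mkcond.
Qed.

Lemma weight_linear c : linear (weight c).
Proof.
move=> a x y; have [n [f [g [Gf Gg -> ->]]]] := deg_decomp2 x y.
rewrite !weight_sum// !scaler_sumr -!big_split /=.
rewrite (weight_sum _ _ (f := fun i => a *: f i + g i)) => [|i]; last exact: degP.
by apply: eq_bigr => i _; rewrite scalerDr !scalerA mulrC.
Qed.

HB.instance Definition _ c := GRing.isLinear.Build F A A *:%R (weight c)
  (weight_linear c).

Lemma weightE c n x : G n x -> weight c x = c n *: x.
Proof.
move=> Gx; pose f i := if i == n then x else 0.
have Gf i : G i (f i) by rewrite /f; case: eqP => [->//|_]; exact: deg0.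
have sE (h : nat -> A) : (forall i, i != n -> h i = 0) -> \sum_(i < n.+1) h i = h n.
  move=> h0; rewrite big_ord_recr /= big1 ?add0r// => i _.
  by apply: h0; rewrite neq_ltn ltn_ord.
have -> : weight c x = weight c (\sum_(i < n.+1) f i).
  by rewrite sE /f ?eqxx// => i /negPf ->.
rewrite weight_sum// (sE (fun i => c i *: f i)); first by rewrite /f eqxx.
by move=> i /negPf ni; rewrite /f ni scaler0.
Qed.

(** The homogeneous component of degree [n]. *)
Definition hcomp n := weight (fun i => (i == n)%:R).

HB.instance Definition _ n := GRing.Linear.on (hcomp n).

Lemma hcompE m n x : G m x -> hcomp n x = (m == n)%:R *: x.
Proof. exact: weightE. Qed.

Lemma hcomp_id n x : G n x -> hcomp n x = x.
Proof. by move=> /(hcompE n) ->; rewrite eqxx scale1r. Qed.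

Lemma hcomp_deg n x : G n (hcomp n x).
Proof.
elim/deg_ind: x => [|x y ihx ihy|m x Gx]; first by rewrite linear0; exact: deg0.
  by rewrite linearD; exact: degD.
rewrite (hcompE n Gx); case: eqP => [<-|_]; first by rewrite scale1r.
by rewrite scale0r; exact: deg0.
Qed.

Lemma hcomp_mulr0 n x y : G 0 y -> hcomp n (x * y) = hcomp n x * y.
Proof.
move=> Gy; elim/deg_ind: x => [|x z ihx ihz|m x Gx].
- by rewrite linear0 !mul0r linear0.
- by rewrite mulrDl !linearD /= ihx ihz mulrDl.
- have := degM Gx Gy; rewrite addn0 => /(hcompE n) ->.
  by rewrite (hcompE n Gx) scalerAl.
Qed.

(** The even part, the odd part, and the parity involution, which acts on
    degree [n] as [(-1) ^+ n]. *)
Definition evenc := weight (fun n => (~~ odd n)%:R).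
Definition oddc := weight (fun n => (odd n)%:R).
Definition parity := weight (fun n => (-1) ^+ n).

HB.instance Definition _ := GRing.Linear.on evenc.
HB.instance Definition _ := GRing.Linear.on oddc.
HB.instance Definition _ := GRing.Linear.on parity.

Lemma parityE n x : G n x -> parity x = (-1) ^+ n *: x.
Proof. exact: weightE. Qed.

End Graded.

(** * The graded tensor product *)

Section GradedTensor.
Variables (F : fieldType) (A B : algType F).
Variables (G : nat -> set A) (H : nat -> set B).
Hypotheses (hG : graded_algebra G) (hH : graded_algebra H).
Notation bilin b := (bilinear_for *:%R *:%R b).

(** The vector space [A (x) B], to be equipped with the product
    [(a (x) b) (a' (x) b') = (-1) ^ (|b| |a'|) a a' (x) b b']. *)
Definition gtensor of graded_algebra G & graded_algebra H : Type := tensor A B.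
Notation T := (gtensor hG hH).
HB.instance Definition _ := GRing.Lmodule.copy T (tensor A B).

Definition gtens (a : A) (b : B) : T := tens a b.

Lemma gtensDl a a' b : gtens (a + a') b = gtens a b + gtens a' b.
Proof. exact: tensDl. Qed.

Lemma gtensDr a b b' : gtens a (b + b') = gtens a b + gtens a b'.
Proof. exact: tensDr. Qed.

Lemma gtensZl k a b : gtens (k *: a) b = k *: gtens a b.
Proof. exact: tensZl. Qed.

Lemma gtensZr k a b : gtens a (k *: b) = k *: gtens a b.
Proof. exact: tensZr. Qed.

Lemma gtens0l b : gtens 0 b = 0.
Proof. exact: tens0l. Qed.

Lemma gtens0r a : gtens a 0 = 0.
Proof. exact: tens0r. Qed.

Lemma gtensor_ind (P : T -> Prop) :
  P 0 -> (forall x y, P x -> P y -> P (x + y)) ->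
  (forall i j a b, G i a -> H j b -> P (gtens a b)) -> forall x, P x.
Proof.
move=> P0 PD PG; apply: (tensor_ind P0 PD) => a b; rewrite -[tens a b]/(gtens a b).
elim/(deg_ind hG): a => [|a a' iha iha'|i a Ga]; first by rewrite gtens0l.
  by rewrite gtensDl; exact: PD.
elim/(deg_ind hH): b => [|b b' ihb ihb'|j b Hb]; first by rewrite gtens0r.
  by rewrite gtensDr; exact: PD.
exact: PG Ga Hb.
Qed.

(** The product of [a (x) b] and [a' (x) b'].  Splitting [a'] into its even and
    odd parts makes the Koszul sign linear in [a'] and [b]. *)
Definition gmul_form (a : A) (b : B) (a' : A) (b' : B) : T :=
  gtens (a * evenc hG a') (b * b') + gtens (a * oddc hG a') (parity hH b * b').

Lemma gmul_form_bilinearr a b : bilin (gmul_form a b).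
Proof.
split=> [b' k x y|a' k x y] /=; rewrite /gmul_form.
  by rewrite !linearP /= !mulrDr -!scalerAr !gtensDl !gtensZl scalerDr addrACA.
by rewrite !mulrDr -!scalerAr !gtensDr !gtensZr scalerDr addrACA.
Qed.

Lemma gmul_form_bilinearl y : bilin (fun a b => tensor_lift (gmul_form a b) y).
Proof.
apply: bilin_sum => -[a' b'].
split=> [b k x z|a k x z] /=; rewrite /gmul_form.
  by rewrite !mulrDl -!scalerAl !gtensDl !gtensZl scalerDr addrACA.
by rewrite !linearP /= !mulrDl -!scalerAl !gtensDr !gtensZr scalerDr addrACA.
Qed.

(** The Koszul product, extended to all tensors. *)
Definition gmul (x y : T) : T :=
  tensor_lift (fun a b => tensor_lift (gmul_form a b) y) x.

Lemma gmulDl : left_distributive gmul +%R.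
Proof. by move=> x y z; rewrite /gmul tensor_liftD//; exact: gmul_form_bilinearl. Qed.

Lemma gmulZl k x y : gmul (k *: x) y = k *: gmul x y.
Proof. by rewrite /gmul tensor_liftZ//; exact: gmul_form_bilinearl. Qed.

Lemma gmul_tensl a b y : gmul (gtens a b) y = tensor_lift (gmul_form a b) y.
Proof. by rewrite /gmul tensor_lift_tens//; exact: gmul_form_bilinearl. Qed.

Lemma gmul0l : left_zero 0 gmul.
Proof. by move=> y; have := gmulZl 0 0 y; rewrite !scale0r. Qed.

Lemma gmulP x k y z : gmul x (k *: y + z) = k *: gmul x y + gmul x z.
Proof.
elim/gtensor_ind: x => [|x x' ihx ihx'|i j a b _ _].
- by rewrite !gmul0l scaler0 addr0.
- by rewrite !gmulDl ihx ihx' scalerDr addrACA.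
- rewrite !gmul_tensl tensor_liftD ?tensor_liftZ//; exact: gmul_form_bilinearr.
Qed.

Lemma gmulDr : right_distributive gmul +%R.
Proof. by move=> x y z; have := gmulP x 1 y z; rewrite !scale1r. Qed.

Lemma gmul0r : right_zero 0 gmul.
Proof. by move=> x; have := gmulP x (-1) 0 0; rewrite scaleN1r addNr scaleN1r addNr. Qed.

Lemma gmulZr k x y : gmul x (k *: y) = k *: gmul x y.
Proof. by have := gmulP x k y 0; rewrite gmul0r !addr0. Qed.

Lemma gmul_tens i j a b a' b' : G i a' -> H j b ->
  gmul (gtens a b) (gtens a' b') = (-1) ^+ (j * i) *: gtens (a * a') (b * b').
Proof.
move=> Ga' Hb; rewrite gmul_tensl tensor_lift_tens; last exact: gmul_form_bilinearr.
rewrite /gmul_form /evenc /oddc !(weightE hG _ Ga') (parityE hH Hb).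
case: (boolP (odd i)) => oi /=.
  rewrite scale0r mulr0 gtens0l add0r scale1r -scalerAl gtensZr.
  by rewrite -[in RHS]signr_odd oddM oi andbT signr_odd.
rewrite scale0r mulr0 gtens0l addr0 scale1r.
by rewrite -signr_odd oddM (negPf oi) andbF scale1r.
Qed.

Lemma gmulA : associative gmul.
Proof.
move=> x y z.
elim/gtensor_ind: x => [|x x' ihx ihx'|i j a b Ga Hb]; first by rewrite !gmul0l.
  by rewrite !gmulDl ihx ihx'.
elim/gtensor_ind: y => [|y y' ihy ihy'|i' j' a' b' Ga' Hb'].
- by rewrite !gmul0l !gmul0r gmul0l.
- by rewrite !(gmulDl, gmulDr) ihy ihy'.
elim/gtensor_ind: z => [|z z' ihz ihz'|i'' j'' a'' b'' Ga'' Hb'']; first by rewrite !gmul0r.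
  by rewrite !gmulDr ihz ihz'.
rewrite (gmul_tens _ _ Ga'' Hb') (gmul_tens _ _ Ga' Hb) gmulZl gmulZr.
rewrite (gmul_tens _ _ (degM hG Ga' Ga'') Hb) (gmul_tens _ _ Ga'' (degM hH Hb Hb')).
rewrite !scalerA -!exprD !mulrA; congr (_ ^+ _ *: _).
by rewrite mulnDl mulnDr [in LHS]addnC addnA.
Qed.

Lemma gmul_deg0r i j a b a' b' : G i a -> H j b -> G 0 a' ->
  gmul (gtens a b) (gtens a' b') = gtens (a * a') (b * b').
Proof. by move=> Ga Hb Ga'; rewrite (gmul_tens _ _ Ga' Hb) muln0 scale1r. Qed.

Lemma gmul1l : left_id (gtens 1 1) gmul.
Proof.
elim/gtensor_ind => [|x y ihx ihy|i j a b Ga Hb]; first by rewrite gmul0r.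
  by rewrite gmulDr ihx ihy.
by rewrite (gmul_tens _ _ Ga (deg_one hH)) scale1r !mul1r.
Qed.

Lemma gmul1r : right_id (gtens 1 1) gmul.
Proof.
elim/gtensor_ind => [|x y ihx ihy|i j a b Ga Hb]; first by rewrite gmul0l.
  by rewrite gmulDl ihx ihy.
by rewrite (gmul_deg0r _ Ga Hb (deg_one hG)) !mulr1.
Qed.

Lemma gtens1_neq0 : gtens 1 1 != 0.
Proof. exact: tensor_one_neq0. Qed.

HB.instance Definition _ := GRing.Zmodule_isNzRing.Build T
  gmulA gmul1l gmul1r gmulDl gmulDr gtens1_neq0.

Lemma gtensor_scaleAl (k : F) (x y : T) : k *: (x * y) = (k *: x : T) * y.
Proof. exact/esym/gmulZl. Qed.

HB.instance Definition _ := GRing.LSemiModule_isLSemiAlgebra.Build F T gtensor_scaleAl.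

Lemma gtensor_scaleAr (k : F) (x y : T) : k *: (x * y) = x * (k *: y : T).
Proof. exact/esym/gmulZr. Qed.

HB.instance Definition _ := GRing.Lalgebra_isAlgebra.Build F T gtensor_scaleAr.

Lemma gtensM i j a b a' b' : G i a' -> H j b ->
  gtens a b * gtens a' b' = (-1) ^+ (j * i) *: gtens (a * a') (b * b').
Proof. exact: gmul_tens. Qed.

End GradedTensor.

(** * The grading of a graded tensor product *)

Section TotalDegree.
Variables (F : fieldType) (A B : algType F).
Variables (G : nat -> set A) (H : nat -> set B).
Hypotheses (hG : graded_algebra G) (hH : graded_algebra H).
Notation T := (gtensor hG hH).
Notation gtens := (gtens hG hH).

(** The component of bidegree [(i, j)]. *)
Definition bicomp i j : T -> T := tmap (hcomp hG i) (hcomp hH j).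
HB.instance Definition _ i j :=
  GRing.isLinear.Build F T T *:%R (bicomp i j) (tmap_linear _ _).

Lemma bicomp_tens i j a b : bicomp i j (gtens a b) = gtens (hcomp hG i a) (hcomp hH j b).
Proof. exact: tmapE. Qed.

Lemma bicompE i j i' j' a b : G i' a -> H j' b ->
  bicomp i j (gtens a b) = ((i' == i) && (j' == j))%:R *: gtens a b.
Proof.
move=> Ga Hb; rewrite bicomp_tens (hcompE hG i Ga) (hcompE hH j Hb).
by rewrite gtensZl gtensZr scalerA -natrM mulnb.
Qed.

(** The component of total degree [n].  The sum is indexed by the degree of the
    left factor. *)
Definition gproj n (x : T) : T := \sum_(i < n.+1) bicomp i (n - i)%N x.

Lemma gproj_linear n : linear (gproj n).
Proof.
move=> k x y; rewrite scaler_sumr -big_split; apply: eq_bigr => i _.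
exact: linearP.
Qed.

HB.instance Definition _ n :=
  GRing.isLinear.Build F T T *:%R (gproj n) (gproj_linear n).

Lemma gprojE n i j a b : G i a -> H j b ->
  gproj n (gtens a b) = ((i + j)%N == n)%:R *: gtens a b.
Proof.
move=> Ga Hb; rewrite /gproj; under eq_bigr do rewrite (bicompE _ _ Ga Hb).
rewrite -scaler_suml; congr (_ *: _).
have [ijn|ijn] := eqVneq (i + j)%N n.
  have lt_in : (i < n.+1)%N by rewrite ltnS -ijn leq_addr.
  rewrite (bigD1 (Ordinal lt_in))//= eqxx.
  have -> : (n - i)%N = j by rewrite -ijn addKn.
  rewrite eqxx big1 ?addr0// => k ki.
  have /negPf -> // : i != k.
  by apply: contraNneq ki => ik; apply/eqP/val_inj; rewrite /= ik.
rewrite big1// => k _; case: eqP => //= ik; case: eqP => //= jk.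
by move: ijn; rewrite ik jk subnKC ?eqxx// -ltnS.
Qed.

(** The elements of total degree [n], as the range of the projection [gproj n]. *)
Definition gdeg n : set T := [set x | gproj n x = x].

Lemma gdeg_tens i j a b : G i a -> H j b -> gdeg (i + j) (gtens a b).
Proof. by move=> Ga Hb; rewrite /gdeg/= (gprojE _ Ga Hb) eqxx scale1r. Qed.

Lemma gdeg_ind n (P : T -> Prop) :
  P 0 -> (forall x y, P x -> P y -> P (x + y)) ->
  (forall i j a b, (i + j)%N = n -> G i a -> H j b -> P (gtens a b)) ->
  forall x, gdeg n x -> P x.
Proof.
move=> P0 PD PG x <-; elim/gtensor_ind: x => [|x y Px Py|i j a b Ga Hb].
- by rewrite linear0.
- by rewrite linearD; exact: PD.
- rewrite (gprojE _ Ga Hb); case: eqP => [ijn|_]; last by rewrite scale0r.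
  by rewrite scale1r; exact: PG Ga Hb.
Qed.

Lemma gdegP n k x y : gdeg n x -> gdeg n y -> gdeg n (k *: x + y).
Proof. by rewrite /gdeg/= => hx hy; rewrite linearP /= hx hy. Qed.

Lemma gdeg0 n : gdeg n 0.
Proof. by rewrite /gdeg/= linear0. Qed.

Lemma gdegD n x y : gdeg n x -> gdeg n y -> gdeg n (x + y).
Proof. by move=> hx hy; rewrite -(scale1r x); exact: gdegP. Qed.

Lemma gdegZ n k x : gdeg n x -> gdeg n (k *: x).
Proof. by move=> hx; rewrite -(addr0 (k *: x)); apply: gdegP => //; exact: gdeg0. Qed.

Lemma gproj_deg n m x : gdeg m x -> gproj n x = (m == n)%:R *: x.
Proof.
move: x; apply: gdeg_ind => [|x y ihx ihy|i j a b <- Ga Hb].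
- by rewrite linear0 scaler0.
- by rewrite linearD /= ihx ihy scalerDr.
- exact: gprojE.
Qed.

Lemma gdeg_gproj n x : gdeg n (gproj n x).
Proof.
elim/gtensor_ind: x => [|x y ihx ihy|i j a b Ga Hb]; first by rewrite linear0; exact: gdeg0.
  by rewrite linearD; exact: gdegD.
rewrite (gprojE _ Ga Hb); case: eqP => [<-|_]; first by apply: gdegZ; exact: gdeg_tens.
by rewrite scale0r; exact: gdeg0.
Qed.

Lemma sum_gproj_ge x : exists n0, forall n, (n0 <= n)%N -> x = \sum_(i < n) gproj i x.
Proof.
elim/gtensor_ind: x => [|x y [n nP] [m mP]|i j a b Ga Hb].
- by exists 0%N => n _; rewrite big1// => i _; rewrite linear0.
- exists (maxn n m) => l; rewrite geq_max => /andP[nl ml].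
  rewrite {1}(nP l nl) {1}(mP l ml) -big_split; apply: eq_bigr => i _.
  by rewrite linearD.
- exists (i + j).+1 => n ijn.
  rewrite (bigD1 (Ordinal ijn))//= (gdeg_tens Ga Hb) big1 ?addr0// => k kij.
  rewrite (gprojE _ Ga Hb); suff /negPf -> : (i + j)%N != k by rewrite scale0r.
  by apply: contraNneq kij => kij; apply/eqP/val_inj; rewrite /= kij.
Qed.

Lemma gdegM m n x y : gdeg m x -> gdeg n y -> gdeg (m + n) (x * y).
Proof.
move=> hx; move: x hx y; apply: gdeg_ind => [|x x' ihx ihx'|i j a b <- Ga Hb] y.
- by rewrite mul0r => _; exact: gdeg0.
- by move=> hy; rewrite mulrDl; apply: gdegD; [exact: ihx|exact: ihx'].
move: y; apply: gdeg_ind => [|y y' ihy ihy'|i' j' a' b' <- Ga' Hb'].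
- by rewrite mulr0; exact: gdeg0.
- by rewrite mulrDr; exact: gdegD.
rewrite (gtensM hG hH _ _ Ga' Hb) addnACA; apply: gdegZ.
by apply: gdeg_tens; [exact: degM|exact: degM].
Qed.

Lemma gtensor_graded : graded_algebra gdeg.
Proof.
split=> [n||x|n f hf f0 i lt_in].
- by split; [exact: gdeg0|exact: gdegP].
- by split; [exact: (gdeg_tens (deg_one hG) (deg_one hH))|exact: gdegM].
- have [n /(_ n (leqnn n)) xE] := sum_gproj_ge x.
  by exists n, (fun i => gproj i x); split=> // i; exact: gdeg_gproj.
- have := congr1 (gproj i) f0; rewrite linear_sum linear0.
  rewrite (bigD1 (Ordinal lt_in))//= (hf i) big1 ?addr0// => k ki.
  rewrite (gproj_deg _ (hf k)); suff /negPf -> : (k : nat) != i by rewrite scale0r.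
  by apply: contraNneq ki => ki; apply/eqP/val_inj.
Qed.

End TotalDegree.
Arguments gdeg {F A B G H} hG hH n _.

(** * The tensor product of two differential calculi *)

(** Signs as elements of an algebra and as scalars. *)
Lemma sign_mul (F : fieldType) (A : algType F) n (x : A) :
  (-1) ^+ n * x = ((-1) ^+ n : F) *: x.
Proof.
by rewrite -signr_odd -[in RHS]signr_odd; case: odd; rewrite ?mulN1r ?scaleN1r ?mul1r ?scale1r.
Qed.

Lemma eq_odd_sign (R : pzRingType) m n : odd m = odd n -> (-1) ^+ m = (-1) ^+ n :> R.
Proof. by move=> mn; rewrite -signr_odd mn signr_odd. Qed.

Section CalculusTheory.
Variables (F : fieldType) (R : algType F) (C : calculus R).
Notation inj := (calc_inj C).
Notation d := (calc_d C).
Notation G := (@calc_deg _ _ C).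

Lemma calc_inj_deg r : G 0 (inj r).
Proof. by rewrite calc_deg0; exists r. Qed.

Lemma calc_d1 : d 1 = 0.
Proof.
have := calc_leibniz 1 (deg_one (calc_graded C)); rewrite !mulr1 !mul1r.
by move=> /eqP; rewrite eq_sym -subr_eq0 addrK => /eqP.
Qed.

Lemma calc_leibnizZ n w v : G n w -> d (w * v) = d w * v + (-1) ^+ n *: (w * d v).
Proof. by move=> Gw; rewrite (calc_leibniz _ Gw) -mulrA sign_mul. Qed.

Lemma calc_d_inj_deg r : G 1 (d (inj r)).
Proof. by apply: calc_d_deg; exact: calc_inj_deg. Qed.

End CalculusTheory.

Section TensorCalculus.
Variables (F : fieldType) (R S : algType F) (OR : calculus R) (OS : calculus S).
Notation A := (calc_alg OR).
Notation B := (calc_alg OS).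
Notation hG := (calc_graded OR).
Notation hH := (calc_graded OS).
Notation G := (@calc_deg _ _ OR).
Notation H := (@calc_deg _ _ OS).
Notation T := (gtensor hG hH).
Notation gtens := (gtens hG hH).
Notation dR := (calc_d OR).
Notation dS := (calc_d OS).
Notation injR := (calc_inj OR).
Notation injS := (calc_inj OS).

(** The inclusion of [R (x) S] as the part of degree [0]. *)
Definition ginj : tensor R S -> T := tmap injR injS.

HB.instance Definition _ :=
  GRing.isLinear.Build F (tensor R S) T *:%R ginj (tmap_linear _ _).

Lemma ginjE r s : ginj (tens r s) = gtens (injR r) (injS s).
Proof. exact: tmapE. Qed.

Lemma ginj_monoid : monoid_morphism ginj.
Proof.
split=> [|x y]; first by rewrite ginjE !rmorph1.
elim/tensor_ind: x => [|x x' ihx ihx'|r s]; first by rewrite mul0r linear0 mul0r.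
  by rewrite mulrDl !linearD /= ihx ihx' mulrDl.
elim/tensor_ind: y => [|y y' ihy ihy'|r' s']; first by rewrite mulr0 linear0 mulr0.
  by rewrite mulrDr !linearD /= ihy ihy' mulrDr.
rewrite tensM !ginjE (gtensM hG hH _ _ (calc_inj_deg OR r') (calc_inj_deg OS s)).
by rewrite scale1r !rmorphM.
Qed.

HB.instance Definition _ := GRing.isMonoidMorphism.Build (tensor R S) T ginj ginj_monoid.

Lemma ginj_inj : injective ginj.
Proof. by apply: tmap_inj; exact: calc_injective. Qed.

Lemma gd_bilinear : bilinear_for *:%R *:%R
  (fun a b => gtens (dR a) b + gtens (parity hG a) (dS b)).
Proof.
split=> [b k x y|a k x y] /=; rewrite !linearP.
  by rewrite !gtensDl !gtensZl scalerDr addrACA.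
by rewrite !gtensDr !gtensZr scalerDr addrACA.
Qed.

(** The differential [d (a (x) b) = d a (x) b + (-1) ^ |a| a (x) d b]. *)
Definition gd : T -> T :=
  tensor_lift (fun a b => gtens (dR a) b + gtens (parity hG a) (dS b)).

HB.instance Definition _ :=
  GRing.isLinear.Build F T T *:%R gd (tensor_lift_linear gd_bilinear).

Lemma gdD x y : gd (x + y) = gd x + gd y.
Proof. exact: linearD. Qed.

Lemma gdZ k x : gd (k *: x) = k *: gd x.
Proof. exact: linearZ. Qed.

Lemma gd0 : gd 0 = 0.
Proof. exact: linear0. Qed.

Lemma gd_tens a b : gd (gtens a b) = gtens (dR a) b + gtens (parity hG a) (dS b).
Proof. exact: tensor_lift_tens gd_bilinear. Qed.

Lemma gdE i a b : G i a -> gd (gtens a b) = gtens (dR a) b + (-1) ^+ i *: gtens a (dS b).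
Proof. by move=> Ga; rewrite gd_tens (parityE hG Ga) gtensZl. Qed.

Lemma gd_deg n x : gdeg hG hH n x -> gdeg hG hH n.+1 (gd x).
Proof.
move: x; apply: gdeg_ind => [|x y ihx ihy|i j a b <- Ga Hb].
- by rewrite gd0; exact: gdeg0.
- by rewrite gdD; exact: gdegD.
rewrite (gdE _ Ga); apply: gdegD.
  by rewrite -addSn; apply: gdeg_tens => //; exact: calc_d_deg.
by apply: gdegZ; rewrite -addnS; apply: gdeg_tens => //; exact: calc_d_deg.
Qed.

Lemma gd_gd x : gd (gd x) = 0.
Proof.
elim/gtensor_ind: x => [|x y ihx ihy|i j a b Ga Hb]; first by rewrite !gd0.
  by rewrite !gdD ihx ihy addr0.
rewrite (gdE _ Ga) gdD gdZ (gdE _ Ga) (gdE _ (calc_d_deg Ga)).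
by rewrite !calc_dd gtens0l gtens0r scaler0 add0r addr0 exprS mulN1r scaleNr addNr.
Qed.

Lemma gd_leibniz n x y : gdeg hG hH n x ->
  gd (x * y) = gd x * y + (-1) ^+ n * x * gd y.
Proof.
move=> hx; rewrite -mulrA sign_mul; move: x hx.
apply: gdeg_ind => [|x x' ihx ihx'|i j a b <- Ga Hb].
- by rewrite gd0 !mul0r gd0 scaler0 addr0.
- by rewrite mulrDl !gdD ihx ihx' !mulrDl scalerDr addrACA.
elim/gtensor_ind: y => [|y y' ihy ihy'|i' j' a' b' Ga' Hb'].
- by rewrite gd0 !mulr0 gd0 scaler0 addr0.
- by rewrite mulrDr !gdD ihy ihy' !mulrDr scalerDr addrACA.
rewrite (gtensM hG hH _ _ Ga' Hb) gdZ (gdE _ (degM hG Ga Ga')).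
rewrite (gdE _ Ga) (gdE _ Ga') (calc_leibnizZ _ Ga) (calc_leibnizZ _ Hb).
rewrite mulrDl mulrDr -scalerAl -scalerAr.
rewrite (gtensM hG hH _ _ Ga' Hb) (gtensM hG hH _ _ Ga' (calc_d_deg Hb)).
rewrite (gtensM hG hH _ _ (calc_d_deg Ga') Hb) (gtensM hG hH _ _ Ga' Hb).
rewrite gtensDl gtensDr gtensZl gtensZr !scalerDr !scalerA -!exprD.
rewrite -!addrA; congr (_ + _); rewrite [LHS]addrCA; congr (_ + _).
  by congr (_ *: _); apply: eq_odd_sign; rewrite !(oddD, oddM) /=;
    case: (odd i); case: (odd j); case: (odd i').
by congr (_ *: _ + _ *: _); apply: eq_odd_sign; rewrite !(oddD, oddM) /=;
  case: (odd i); case: (odd j); case: (odd i').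
Qed.

Lemma gdeg_0 : gdeg hG hH 0 = range ginj.
Proof.
apply/seteqP; split=> [|_ [r _ <-]]; last first.
  elim/tensor_ind: r => [|x y ihx ihy|r s]; first by rewrite linear0; exact: gdeg0.
    by rewrite linearD; exact: gdegD.
  rewrite ginjE; apply: (gdeg_tens hG hH (i := 0) (j := 0)); exact: calc_inj_deg.
apply: gdeg_ind => [|x y [r _ <-] [s _ <-]|i j a b].
- by exists 0 => //; rewrite linear0.
- by exists (r + s) => //; rewrite linearD.
move=> /eqP; rewrite addn_eq0 => /andP[/eqP -> /eqP ->].
by rewrite !calc_deg0 => -[r _ <-] [s _ <-]; exists (tens r s) => //; rewrite ginjE.
Qed.

Lemma gd_ginj_l r : gd (ginj (tens r 1)) = gtens (dR (injR r)) 1.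
Proof.
rewrite ginjE rmorph1 (gdE _ (calc_inj_deg OR r)) calc_d1.
by rewrite gtens0r scaler0 addr0.
Qed.

Lemma gd_ginj_r s : gd (ginj (tens 1 s)) = gtens 1 (dS (injS s)).
Proof.
rewrite ginjE rmorph1 (gdE _ (deg_one hG)) calc_d1.
by rewrite gtens0l add0r scale1r.
Qed.

Lemma gtens_prodl n (a : 'I_n -> A) :
  gtens (\prod_(i < n) a i) 1 = \prod_(i < n) gtens (a i) 1.
Proof.
apply: (big_morph (fun a => gtens a 1)) => // x y.
elim/(deg_ind hG): y => [|y y' ihy ihy'|i y Gy]; first by rewrite mulr0 gtens0l mulr0.
  by rewrite mulrDr !gtensDl ihy ihy' mulrDr.
by rewrite (gtensM hG hH _ _ Gy (deg_one hH)) scale1r mul1r.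
Qed.

Lemma gtens_prodr n (b : 'I_n -> B) :
  gtens 1 (\prod_(i < n) b i) = \prod_(i < n) gtens 1 (b i).
Proof.
apply: (big_morph (gtens 1)) => // x y.
elim/(deg_ind hH): x => [|x x' ihx ihx'|i x Gx]; first by rewrite mul0r gtens0r mul0r.
  by rewrite mulrDl !gtensDr ihx ihx' mulrDl.
by rewrite (gtensM hG hH _ _ (deg_one hG) Gx) muln0 scale1r mul1r.
Qed.

Lemma gtens_split a b s r : G 0 r -> H 0 s ->
  gtens (r * a) (s * b) = gtens r s * gtens a 1 * gtens 1 b.
Proof.
move=> Gr Hs.
elim/(deg_ind hG): a => [|a a' iha iha'|i a Ga].
- by rewrite mulr0 !gtens0l mulr0 mul0r.
- by rewrite mulrDr !gtensDl iha iha' mulrDr mulrDl.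
rewrite (gtensM hG hH _ _ Ga Hs) scale1r mulr1.
by rewrite (gtensM hG hH _ _ (deg_one hG) Hs) scale1r mulr1.
Qed.

(** Density: the tensor product of [r d r_1 ... d r_i] and [s d s_1 ... d s_j] is
    [(r (x) s) d (r_1 (x) 1) ... d (r_i (x) 1) d (1 (x) s_1) ... d (1 (x) s_j)]. *)
Lemma gdeg_dense n : gdeg hG hH n =
  lin_span [set w | exists (r : tensor R S) (s : 'I_n -> tensor R S),
     w = ginj r * \prod_(i < n) gd (ginj (s i))].
Proof.
apply/seteqP; split.
  apply: gdeg_ind => [|x y|i j a b <- {n}]; [exact: lin_span0|exact: lin_spanD|].
  rewrite !calc_dense => Ga Hb; move: a Ga.
  apply: lin_span_min => [|a a'|k a|_ [r [f ->]]].
  - by rewrite gtens0l; exact: lin_span0.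
  - by rewrite gtensDl; exact: lin_spanD.
  - by rewrite gtensZl; exact: lin_spanZ.
  move: b Hb; apply: lin_span_min => [|b b'|k b|_ [s [g ->]]].
  - by rewrite gtens0r; exact: lin_span0.
  - by rewrite gtensDr; exact: lin_spanD.
  - by rewrite gtensZr; exact: lin_spanZ.
  apply: lin_span_gen; exists (tens r s), (fun k => match fintype.split k with
    | inl k => tens (f k) 1 | inr k => tens 1 (g k) end).
  rewrite big_split_ord /= ginjE mulrA.
  rewrite (gtens_split _ _ (calc_inj_deg OR r) (calc_inj_deg OS s)).
  rewrite gtens_prodl gtens_prodr; congr (_ * _ * _); apply: eq_bigr => k _.
    by rewrite (unsplitK (inl _ k)) gd_ginj_l.
  by rewrite (unsplitK (inr _ k)) gd_ginj_r.
have gr := gtensor_graded hG hH.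
apply: lin_span_min => [|x y|k x|_ [r [s ->]]].
- exact: gdeg0.
- exact: gdegD.
- exact: gdegZ.
have g0 t : gdeg hG hH 0 (ginj t) by rewrite gdeg_0; exists t.
rewrite -[n in gdeg _ _ n]add0n; apply: gdegM => //.
elim: n s => [|n ihn] s; first by rewrite big_ord0; exact: deg_one gr.
by rewrite big_ord_recl; apply: (gdegM (m := 1)) => //; exact: gd_deg.
Qed.

(** The graded tensor product of two differential calculi, as a calculus over
    the tensor product algebra. *)
Definition tensor_calculus : calculus (tensor R S) :=
  @Calculus F (tensor R S) T (gdeg hG hH) ginj gd (gtensor_graded hG hH)
    ginj_inj gdeg_0 gd_deg gd_gd gd_leibniz gdeg_dense.

End TensorCalculus.

(** * Volume forms and integrability *)

Section Volume.
Variables (F : fieldType) (R : algType F) (C : calculus R).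
Notation A := (calc_alg C).
Notation inj := (calc_inj C).
Notation G := (@calc_deg _ _ C).
Notation hG := (calc_graded C).

(** Maps [Omega R -> R] that are linear over [R] on the right. *)
Definition right_linear (f : A -> R) : Prop :=
  forall (r : R) (x y : A), f (x * inj r + y) = f x * r + f y.

Section RightLinear.
Variables (f : A -> R) (hf : right_linear f).

Lemma right_linear0 : f 0 = 0.
Proof.
have := hf 1 0 0; rewrite mul0r addr0 mulr1.
by move=> /eqP; rewrite -subr_eq0 opprD addNKr oppr_eq0 => /eqP.
Qed.

Lemma right_linearD x y : f (x + y) = f x + f y.
Proof. by have := hf 1 x y; rewrite rmorph1 !mulr1. Qed.

Lemma right_linearM x r : f (x * inj r) = f x * r.
Proof. by have := hf r x 0; rewrite !addr0 right_linear0 addr0. Qed.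

Lemma right_linear_sum n (x : 'I_n -> A) : f (\sum_(i < n) x i) = \sum_(i < n) f (x i).
Proof. exact: (big_morph f right_linearD right_linear0). Qed.

End RightLinear.

Variables (N : nat) (v : A).

(** Perfectness of the pairing [(g, g') |-> pi_v (g g')] between degrees [k] and
    [m], without reference to the co-ordinate map: it is nondegenerate on the
    left and represents every right linear form.  The forms are defined on the
    whole algebra, which is no restriction: a form on degree [m] extends by
    composition with the projection to degree [m]. *)
Definition perfect_pairing k m : Prop :=
  (forall g, G k g -> (forall g', G m g' -> g * g' = 0) -> g = 0) /\
  (forall f, right_linear f ->
     exists2 g, G k g & forall g', G m g' -> g * g' = v * inj (f g')).

Hypothesis hv : volume_form N v.

Lemma volume_form_injr r s : v * inj r = v * inj s -> r = s.
Proof. by case: hv => _ _ [_ vI _]; apply: vI; rewrite inE. Qed.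

Lemma volume_form_injl r s : inj r * v = inj s * v -> r = s.
Proof. by case: hv => _ [_ vI _] _; apply: vI; rewrite inE. Qed.

Lemma volume_form_neq0 : G N <> [set 0].
Proof.
case: (hv) => Gv _ _ G0; move: Gv; rewrite G0 /= => v0.
have := @volume_form_injr 1 0; rewrite v0 !mul0r => /(_ erefl)/eqP.
by rewrite oner_eq0.
Qed.

Lemma coordinateK r : coordinate v (v * inj r) = r.
Proof.
rewrite /coordinate; case: xgetP => [s _ /volume_form_injr//|/(_ r)/=].
by case.
Qed.

Lemma coordinate_mul w : G N w -> v * inj (coordinate v w) = w.
Proof.
by case: hv => _ _ [_ _ vS] /vS[r _ <-]; rewrite coordinateK.
Qed.

Lemma integrable_calculusP : integrable_calculus N v <->
  forall k, (k <= N)%N -> perfect_pairing k (N - k).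
Proof.
have cE k g g' : (k <= N)%N -> G k g -> G (N - k)%N g' -> 
    v * inj (coordinate v (g * g')) = g * g'.
  by move=> kN Gg Gg'; apply: coordinate_mul; rewrite -(subnKC kN); exact: (degM hG).
have GP k (x : G k) : G k (val x) by exact: set_mem (valP x).
split=> h k kN.
  have [_ hI hS] := h k kN; split=> [g Gg g0|f hf].
    have : @ell _ _ C N v k (SigSub (mem_set Gg)) =
           @ell _ _ C N v k (SigSub (mem_set (deg0 hG k))).
      by apply/funext => g'; rewrite /ell /= mul0r g0//; exact: GP.
    by move=> /hI; rewrite !inE => /(_ I I)/(congr1 val).
  have : @right_hom _ _ C (N - k)%N (fun x => f (val x)).
    by move=> r x y z ->; exact: hf.
  move=> /hS[g _ gf]; exists (val g) => // g' Gg'.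
  have := congr1 (fun u => u (SigSub (mem_set Gg'))) gf.
  by rewrite /ell /= => <-; rewrite (cE k)//; exact: GP.
have [hI hS] := h k kN; split=> [g _|g1 g2 _ _ g12|f hf].
- move=> r x y z zE.
  have gE u := cE k (val g) (val u) kN (GP _ g) (GP _ u).
  apply: volume_form_injr; rewrite /ell rmorphD rmorphM mulrDr mulrA !gE.
  by rewrite zE mulrDr mulrA.
- apply/val_inj/subr0_eq; apply: hI.
    by rewrite addrC -scaleN1r; apply: (degP hG).
  move=> g' Gg'; have := congr1 (fun u => u (SigSub (mem_set Gg'))) g12.
  rewrite /ell /= => /(congr1 (fun r => v * inj r)).
  by rewrite !(cE k) => //; try exact: GP; rewrite mulrBl => ->; rewrite subrr.
(* A form on degree N - k extends to Omega R by the projection. *)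
- pose f' x := f (SigSub (mem_set (hcomp_deg hG (N - k)%N x))).
  have /hS[g Gg gf] : right_linear f'.
    move=> r x y; rewrite /f'; apply: hf => /=.
    by rewrite linearD /= hcomp_mulr0//; exact: calc_inj_deg.
  exists (SigSub (mem_set Gg)) => //; apply/funext => x.
  rewrite /ell /= (gf _ (GP _ x)) coordinateK /f'; congr f; apply: val_inj => /=.
  by rewrite (hcomp_id _ (GP _ x)).
Qed.

(** The dual basis of [Omega R] as a finitely generated projective right module:
    the coordinates of a section of a surjection from a free module. *)
Lemma dual_basis : fg_projective_right C ->
  exists n (e : 'I_n -> A) (h : 'I_n -> A -> R),
    (forall i, right_linear (h i)) /\ forall x, x = \sum_(i < n) e i * inj (h i x).
Proof.
move=> [[n [e espan]] proj].
pose M := right_module C.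
pose g (u : 'rV[R^c]_n) : M := \sum_(i < n) u 0 i *: e i.
have glin : linear g.
  move=> a u w; rewrite /g scaler_sumr -big_split; apply: eq_bigr => i _ /=.
  by rewrite !mxE scalerDl scalerA.
pose mg := GRing.isLinear.Build R^c 'rV[R^c]_n M *:%R g glin.
pose gl : {linear 'rV[R^c]_n -> M} := HB.pack g mg.
have gsurj x : exists u, gl u = x.
  have : lin_span (range e) x by rewrite espan.
  move: x; apply: lin_span_min => [|x y [u <-] [w <-]|a x [u <-]|_ [i _ <-]].
  - by exists 0; rewrite linear0.
  - by exists (u + w); rewrite linearD.
  - by exists (a *: u); rewrite linearZ.
  - exists (delta_mx 0 i); rewrite /gl/= /g (bigD1 i)//= big1 ?addr0 => [|j ji].
      by rewrite mxE !eqxx scale1r.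
    by rewrite mxE (negPf ji) andbF scale0r.
have [h hE] := proj _ _ gl (idfun : {linear M -> M}) gsurj.
exists n, e, (fun i x => h x 0 i); split=> [i r x y|x].
  have -> : h (x * inj r + y) = (r : R^c) *: h x + h y by rewrite -linearP.
  by rewrite !mxE.
by rewrite -[LHS]hE.
Qed.

End Volume.

(** * Finite generation of a tensor product of algebras *)

Section AffineTensor.
Variables (F : fieldType) (R S : algType F).

Lemma tens_prodl n (r : 'I_n -> R) :
  tens (\prod_(i < n) r i) (1 : S) = \prod_(i < n) tens (r i) 1.
Proof. by apply: (big_morph (fun r => tens r 1)) => // x y; rewrite tensM mul1r. Qed.

Lemma tens_prodr n (s : 'I_n -> S) :
  tens (1 : R) (\prod_(i < n) s i) = \prod_(i < n) tens 1 (s i).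
Proof. by apply: (big_morph (tens 1)) => // x y; rewrite tensM mul1r. Qed.

Lemma affine_tensor : affine R -> affine S -> affine (tensor R S).
Proof.
move=> [n [e eR]] [m [f fS]].
exists (n + m)%N, (fun k => match fintype.split k with
  | inl i => tens (e i) 1 | inr j => tens 1 (f j) end).
apply/seteqP; split=> // x _.
elim/tensor_ind: x => [|x y|r s]; [exact: lin_span0|exact: lin_spanD|].
have : [set: R] r by [].
rewrite -eR; move: r; apply: lin_span_min => [|r r'|a r|_ [k [w ->]]].
- by rewrite tens0l; exact: lin_span0.
- by rewrite tensDl; exact: lin_spanD.
- by rewrite tensZl; exact: lin_spanZ.
have : [set: S] s by [].
rewrite -fS; move: s; apply: lin_span_min => [|s s'|a s|_ [l [z ->]]].
- by rewrite tens0r; exact: lin_span0.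
- by rewrite tensDr; exact: lin_spanD.
- by rewrite tensZr; exact: lin_spanZ.
apply: lin_span_gen; exists (k + l)%N, (fun i => match fintype.split i with
  | inl i => lshift m (w i) | inr j => rshift n (z j) end).
rewrite big_split_ord /= -[\prod_(i < k) _]mulr1 -[X in tens _ X]mul1r -tensM.
rewrite tens_prodl tens_prodr; congr (_ * _); apply: eq_bigr => i _.
  by rewrite (unsplitK (inl _ i)) (unsplitK (inl _ (w i))).
by rewrite (unsplitK (inr _ i)) (unsplitK (inr _ (z i))).
Qed.

End AffineTensor.

(** * Smoothness of the tensor product calculus *)

Section LinearMultiplications.
Variables (F : fieldType) (R : algType F) (C : calculus R).
Notation A := (calc_alg C).
Notation inj := (calc_inj C).

(** The maps [r |-> r v] and [r |-> v r], the map [a |-> a_i w] with [a_i] the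
    component of degree [i] of [a], and the restriction of [d] to [R], as linear
    maps over the ground field. *)
Definition inj_mul (v : A) (r : R) : A := inj r * v.

Lemma inj_mul_linear v : linear (inj_mul v).
Proof. by move=> k x y; rewrite /inj_mul linearP mulrDl scalerAl. Qed.

HB.instance Definition _ v :=
  GRing.isLinear.Build F R A *:%R (inj_mul v) (inj_mul_linear v).

Definition mul_inj (v : A) (r : R) : A := v * inj r.

Lemma mul_inj_linear v : linear (mul_inj v).
Proof. by move=> k x y; rewrite /mul_inj linearP mulrDr scalerAr. Qed.

HB.instance Definition _ v :=
  GRing.isLinear.Build F R A *:%R (mul_inj v) (mul_inj_linear v).

Definition hcomp_mul i (w a : A) : A := hcomp (calc_graded C) i a * w.

Lemma hcomp_mul_linear i w : linear (hcomp_mul i w).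
Proof. by move=> k x y; rewrite /hcomp_mul linearP mulrDl scalerAl. Qed.

HB.instance Definition _ i w :=
  GRing.isLinear.Build F A A *:%R (hcomp_mul i w) (hcomp_mul_linear i w).

Definition d_inj (r : R) : A := calc_d C (inj r).

Lemma d_inj_linear : linear d_inj.
Proof. by move=> k x y; rewrite /d_inj !linearP. Qed.

HB.instance Definition _ := GRing.isLinear.Build F R A *:%R d_inj d_inj_linear.

End LinearMultiplications.

Section TensorCalculusTheory.
Variables (F : fieldType) (R S : algType F) (OR : calculus R) (OS : calculus S).
Notation A := (calc_alg OR).
Notation B := (calc_alg OS).
Notation hG := (calc_graded OR).
Notation hH := (calc_graded OS).
Notation G := (@calc_deg _ _ OR).
Notation H := (@calc_deg _ _ OS).
Notation T := (gtensor hG hH).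
Notation gtens := (gtens hG hH).
Notation injR := (calc_inj OR).
Notation injS := (calc_inj OS).
Notation TC := (tensor_calculus OR OS).

(** The components of [d x] of bidegrees [(1, 0)] and [(0, 1)] vanish separately.
    The first forces [x = 1 (x) s], the second then forces [s] to be scalar. *)
Lemma connected_tensor : connected_calculus OR -> connected_calculus OS ->
  connected_calculus TC.
Proof.
move=> cR cS x; split=> [dx|[a ->]]; last first.
  by rewrite !linearZ /= rmorph1 (calc_d1 TC) scaler0.
(* The forms f and g split off the scalars in R and S. *)
have [f f1] := exists_linear_form (oner_neq0 R).
have [g g1] := exists_linear_form (oner_neq0 S).
have dE1 y : bicomp 1 0 (gd (ginj OR OS y)) = tmap (@d_inj _ _ OR) injS y.
  elim/tensor_ind: y => [|y z ihy ihz|r s]; first by rewrite !linear0.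
    by rewrite !linearD /= ihy ihz.
  rewrite ginjE (gdE _ (calc_inj_deg OR r)) linearD linearZ /=.
  rewrite (bicompE hG hH _ _ (calc_d_inj_deg OR r) (calc_inj_deg OS s)).
  rewrite (bicompE hG hH _ _ (calc_inj_deg OR r) (calc_d_inj_deg OS s)).
  by rewrite scale0r scaler0 addr0 scale1r tmapE.
have dE2 y : bicomp 0 1 (gd (ginj OR OS y)) = tmap injR (@d_inj _ _ OS) y.
  elim/tensor_ind: y => [|y z ihy ihz|r s]; first by rewrite !linear0.
    by rewrite !linearD /= ihy ihz.
  rewrite ginjE (gdE _ (calc_inj_deg OR r)) linearD linearZ /=.
  rewrite (bicompE hG hH _ _ (calc_d_inj_deg OR r) (calc_inj_deg OS s)).
  rewrite (bicompE hG hH _ _ (calc_inj_deg OR r) (calc_d_inj_deg OS s)).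
  by rewrite scale0r add0r !scale1r tmapE.
have kp r : d_inj OR r = 0 -> kill_vector 1 f r = 0.
  by move=> /(cR r)[a ->]; exact: kill_vectorZ.
have kq s : d_inj OS s = 0 -> kill_vector 1 g s = 0.
  by move=> /(cS s)[a ->]; exact: kill_vectorZ.
have px : tmap (kill_vector 1 f) idfun x = 0.
  apply: (tmap_ker (I := unit) (J := unit) (f := fun=> @d_inj _ _ OR) (g := fun=> injS)).
  - by move=> r /(_ tt); exact: kp.
  - by move=> s /(_ tt) s0; apply: (@calc_injective _ _ OS); rewrite s0 linear0.
  - by move=> _ _; rewrite -dE1 [gd _]dx linear0.
have qx : tmap idfun (kill_vector 1 g) x = 0.
  apply: (tmap_ker (I := unit) (J := unit) (f := fun=> injR) (g := fun=> @d_inj _ _ OS)).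
  - by move=> r /(_ tt) r0; apply: (@calc_injective _ _ OR); rewrite r0 linear0.
  - by move=> s /(_ tt); exact: kq.
  - by move=> _ _; rewrite -dE2 [gd _]dx linear0.
move: px; rewrite tmap_kill_vectorl => /subr0_eq xE.
move: qx; rewrite tmap_kill_vectorr => /subr0_eq ->.
by exists (g (contractl f x)); rewrite {1}xE contractrE tensZl.
Qed.

Section TopDegree.
Variables (N M : nat).
Hypotheses (dimR : calculus_dimension OR N) (dimS : calculus_dimension OS M).

Lemma degR_gt0 i a : G i a -> (N < i)%N -> a = 0.
Proof. by move=> Ga /(dimR.2 i) Gi; move: Ga; rewrite Gi. Qed.

Lemma degS_gt0 j b : H j b -> (M < j)%N -> b = 0.
Proof. by move=> Hb /(dimS.2 j) Hj; move: Hb; rewrite Hj. Qed.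

Lemma gdeg_gt0 n : (N + M < n)%N -> gdeg hG hH n = [set 0].
Proof.
move=> NMn; apply/seteqP; split=> [|_ ->]; last exact: gdeg0.
apply: gdeg_ind => [|x y /= -> ->|i j a b ijn Ga Hb] //=; first by rewrite addr0.
have [Ni|iN] := ltnP N i; first by rewrite (degR_gt0 Ga Ni) gtens0l.
have [Mj|jM] := ltnP M j; first by rewrite (degS_gt0 Hb Mj) gtens0r.
by move: NMn; rewrite -ijn ltnNge leq_add.
Qed.

(** In total degree [N + M] only the bidegree [(N, M)] occurs. *)
Lemma gdeg_top_ind (P : T -> Prop) :
  P 0 -> (forall x y, P x -> P y -> P (x + y)) ->
  (forall a b, G N a -> H M b -> P (gtens a b)) ->
  forall x, gdeg hG hH (N + M) x -> P x.
Proof.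
move=> P0 PD PG; apply: gdeg_ind => // i j a b ijn Ga Hb.
have [Ni|iN] := ltnP N i; first by rewrite (degR_gt0 Ga Ni) gtens0l.
have [Mj|jM] := ltnP M j; first by rewrite (degS_gt0 Hb Mj) gtens0r.
have iE : i = N.
  apply/eqP; rewrite eqn_leq iN -(leq_add2r M) -ijn leq_add2l//.
by move: ijn Ga Hb; rewrite iE => /addnI ->; exact: PG.
Qed.

Variables (v : A) (v' : B).
Hypotheses (hv : volume_form N v) (hv' : volume_form M v').

Lemma ginj_mul_volume r : ginj OR OS r * gtens v v' = tmap (inj_mul v) (inj_mul v') r.
Proof.
elim/tensor_ind: r => [|x y ihx ihy|r s]; first by rewrite !linear0 mul0r.
  by rewrite !linearD /= mulrDl ihx ihy.
have [Gv _ _] := hv.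
by rewrite ginjE (gtensM hG hH _ _ Gv (calc_inj_deg OS s)) scale1r tmapE.
Qed.

Lemma volume_mul_ginj r : gtens v v' * ginj OR OS r = tmap (mul_inj v) (mul_inj v') r.
Proof.
elim/tensor_ind: r => [|x y ihx ihy|r s]; first by rewrite !linear0 mulr0.
  by rewrite !linearD /= mulrDr ihx ihy.
have [Hv' _ _] := hv'.
by rewrite ginjE (gtensM hG hH _ _ (calc_inj_deg OR r) Hv') muln0 scale1r tmapE.
Qed.

Lemma volume_form_tensor : @volume_form _ _ TC (N + M) (gtens v v').
Proof.
have [Gv [_ _ vS] [_ _ vS']] := hv; have [Hv' [_ _ wS] [_ _ wS']] := hv'.
have deg0_ginj r : gdeg hG hH 0 (ginj OR OS r) by rewrite gdeg_0; exists r.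
have degV : gdeg hG hH (N + M) (gtens v v') by exact: gdeg_tens.
split=> //; split.
- by move=> r _; rewrite -[(N + M)%N]add0n; exact: gdegM (deg0_ginj r) degV.
- move=> r s _ _ /=; rewrite [LHS]ginj_mul_volume [RHS]ginj_mul_volume.
  apply: tmap_inj => x y; first exact: (volume_form_injl hv).
  exact: (volume_form_injl hv').
- apply: gdeg_top_ind => [|x y [r _ <-] [s _ <-]|a b].
  + by exists 0 => //; rewrite linear0 mul0r.
  + by exists (r + s) => //; rewrite linearD mulrDl.
  + move=> /vS[r _ <-] /wS[s _ <-]; exists (tens r s) => //.
    by rewrite [LHS]ginj_mul_volume tmapE.
- by move=> r _; rewrite -[(N + M)%N]addn0; exact: gdegM degV (deg0_ginj r).
- move=> r s _ _ /=; rewrite [LHS]volume_mul_ginj [RHS]volume_mul_ginj.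
  apply: tmap_inj => x y; first exact: (volume_form_injr hv).
  exact: (volume_form_injr hv').
- apply: gdeg_top_ind => [|x y [r _ <-] [s _ <-]|a b].
  + by exists 0 => //; rewrite linear0 mulr0.
  + by exists (r + s) => //; rewrite linearD mulrDr.
  + move=> /vS'[r _ <-] /wS'[s _ <-]; exists (tens r s) => //.
    by rewrite [LHS]volume_mul_ginj tmapE.
Qed.

Lemma dimension_tensor : calculus_dimension TC (N + M).
Proof.
split; last by move=> n; exact: gdeg_gt0.
exact: volume_form_neq0 volume_form_tensor.
Qed.

Hypotheses (intR : integrable_calculus N v) (intS : integrable_calculus M v').

(** Multiplying by [w (x) w'] of bidegree [(N - i, M - j)] and projecting to top
    bidegree isolates the component of bidegree [(i, j)]. *)
Lemma bicomp_mul i j w w' (x : T) : (i <= N)%N -> (j <= M)%N ->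
  G (N - i)%N w -> H (M - j)%N w' ->
  tmap (hcomp_mul i w) (hcomp_mul j w') x =
  (-1) ^+ (j * (N - i)) *: bicomp N M (x * gtens w w').
Proof.
move=> iN jM Gw Hw'; elim/gtensor_ind: x => [|x y ihx ihy|i' j' a b Ga Hb].
- by rewrite mul0r !linear0.
- by rewrite mulrDl !linearD /= ihx ihy.
rewrite (gtensM hG hH _ _ Gw Hb) linearZ /=.
rewrite (bicompE hG hH _ _ (degM hG Ga Gw) (degM hH Hb Hw')).
rewrite tmapE /= /hcomp_mul (hcompE hG i Ga) (hcompE hH j Hb).
have -> : (i' + (N - i) == N)%N = (i' == i) by rewrite -{2}(subnKC iN) eqn_add2r.
have -> : (j' + (M - j) == M)%N = (j' == j) by rewrite -{2}(subnKC jM) eqn_add2r.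
have [_|_] := eqVneq i' i; last by rewrite scale0r mul0r tens0l scale0r !scaler0.
have [->|_] := eqVneq j' j; last by rewrite !scale0r mul0r tens0r !scaler0.
by rewrite !scale1r scalerA -exprD addnn -signr_odd odd_double scale1r.
Qed.

Lemma perfect_tensor_inj k x : (k <= N + M)%N -> gdeg hG hH k x ->
  (forall y, gdeg hG hH (N + M - k) y -> x * y = 0) -> x = 0.
Proof.
move=> kNM xk x0; rewrite -[x]xk; apply: big1 => i _.
have ik : (i <= k)%N by rewrite -ltnS.
set j := (k - i)%N.
have b0 (a : A) (b : B) : hcomp hG i a = 0 \/ hcomp hH j b = 0 ->
    bicomp i j (gtens a b) = 0.
  by rewrite bicomp_tens => -[] ->; rewrite ?gtens0l ?gtens0r.
have [Ni|iN] := ltnP N i.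
  elim/gtensor_ind: {xk x0} x => [|x y ihx ihy|i' j' a b _ _]; first exact: linear0.
    by rewrite linearD /= ihx ihy addr0.
  by apply: b0; left; exact: degR_gt0 (hcomp_deg hG i a) Ni.
have [Mj|jM] := ltnP M j.
  elim/gtensor_ind: {xk x0} x => [|x y ihx ihy|i' j' a b _ _]; first exact: linear0.
    by rewrite linearD /= ihx ihy addr0.
  by apply: b0; right; exact: degS_gt0 (hcomp_deg hH j b) Mj.
have [nR _] := (integrable_calculusP hv).1 intR i iN.
have [nS _] := (integrable_calculusP hv').1 intS j jM.
apply: (tmap_ker (I := {w | G (N - i)%N w}) (J := {w | H (M - j)%N w})
  (f := fun w => hcomp_mul i (sval w)) (g := fun w => hcomp_mul j (sval w))).
- move=> a a0; apply: nR; first exact: hcomp_deg.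
  by move=> w Gw; exact: (a0 (exist _ w Gw)).
- move=> b b'0; apply: nS; first exact: hcomp_deg.
  by move=> w Hw; exact: (b'0 (exist _ w Hw)).
move=> [w Gw] [w' Hw'] /=; rewrite (bicomp_mul x iN jM Gw Hw') x0.
  by rewrite linear0 scaler0.
have -> : (N + M - k = (N - i) + (M - j))%N.
  by apply/(@addnI k); rewrite subnKC// -{1}(subnKC ik) addnACA !subnKC.
exact: gdeg_tens.
Qed.

(** A right linear form on the part of bidegree [(p, q)] is multiplication by an
    element of bidegree [(i, j)], where [i + p = N] and [j + q = M].  This is
    where projectivity is used: a dual basis writes the form as a finite sum of
    products of right linear forms on the two factors. *)
Lemma perfect_tensor_bideg i j p q (f : T -> tensor R S) :
  (i + p = N)%N -> (j + q = M)%N ->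
  fg_projective_right OR -> fg_projective_right OS ->
  right_linear (C := TC) f ->
  exists2 g, gdeg hG hH (i + j) g &
    forall p' q' w w', (p' + q' = p + q)%N -> G p' w -> H q' w' ->
      g * gtens w w' = (p' == p)%:R *: (gtens v v' * ginj OR OS (f (gtens w w'))).
Proof.
move=> ipN jqM pR pS hf.
pose P (phi : A -> B -> tensor R S) := exists2 g, gdeg hG hH (i + j) g &
  forall p' q' w w', (p' + q' = p + q)%N -> G p' w -> H q' w' ->
    g * gtens w w' = (p' == p)%:R *: (gtens v v' * ginj OR OS (phi w w')).
have P_sum n (phi : 'I_n -> A -> B -> tensor R S) :
    (forall l, P (phi l)) -> P (fun w w' => \sum_(l < n) phi l w w').
  move=> hphi; have [g gP] := choice (fun l => (let: ex_intro2 g g1 g2 := hphi l in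
    ex_intro _ g (conj g1 g2))).
  exists (\sum_(l < n) g l).
    by apply: (big_ind (gdeg hG hH (i + j))) => [|x y|l _];
      [exact: gdeg0|exact: gdegD|exact: (gP l).1].
  move=> p' q' w w' pq Gw Hw; rewrite mulr_suml [ginj _ _ _]linear_sum /=.
  rewrite mulr_sumr scaler_sumr.
  by apply: eq_bigr => l _; apply: (gP l).2 pq Gw Hw.
have P_tens (h : A -> R) (h' : B -> S) y : right_linear h -> right_linear h' ->
    P (fun w w' => y * tens (h w) (h' w')).
  move=> hh hh'; elim/tensor_ind: y => [|y z [g g1 g2] [g' g1' g2']|r s].
  - exists 0; first exact: gdeg0.
    by move=> *; rewrite !mul0r linear0 mulr0 scaler0.
  - exists (g + g'); first exact: gdegD.
    move=> p' q' w w' pq Gw Hw; rewrite mulrDl (g2 _ _ _ _ pq Gw Hw).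
    by rewrite (g2' _ _ _ _ pq Gw Hw) mulrDl linearD mulrDr scalerDr.
  have iN : (i <= N)%N by rewrite -ipN leq_addr.
  have jM : (j <= M)%N by rewrite -jqM leq_addr.
  have pE : (N - i)%N = p by rewrite -ipN addKn.
  have qE : (M - j)%N = q by rewrite -jqM addKn.
  have [_ sR] := (integrable_calculusP hv).1 intR i iN.
  have [_ sS] := (integrable_calculusP hv').1 intS j jM.
  have [|a Ga aE] := sR (fun w => r * h w).
    by move=> t x y; rewrite hh mulrDr mulrA.
  have [|b Hb bE] := sS (fun w => s * h' w).
    by move=> t x y; rewrite hh' mulrDr mulrA.
  rewrite pE in aE; rewrite qE in bE.
  exists ((-1) ^+ (j * p) *: gtens a b); first by apply: gdegZ; exact: gdeg_tens.
  move=> p' q' w w' pq Gw Hw'; rewrite -scalerAl (gtensM hG hH _ _ Gw Hb).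
  (* If p' <> p, one of the two factors has degree above the dimension. *)
  have [pp|p'p|p'p] := ltngtP p' p.
  - have Mq : (M < j + q')%N.
      by rewrite -jqM ltn_add2l -(ltn_add2l p') pq ltn_add2r.
    by rewrite (degS_gt0 (degM hH Hb Hw') Mq) gtens0r !scaler0 scale0r.
  - have Np : (N < i + p')%N by rewrite -ipN ltn_add2l.
    by rewrite (degR_gt0 (degM hG Ga Gw) Np) gtens0l !scaler0 scale0r.
  move: pq Gw; rewrite p'p => /addnI q'q Gw; rewrite q'q in Hw'.
  rewrite scalerA -exprD addnn -signr_odd odd_double !scale1r.
  by rewrite (aE _ Gw) (bE _ Hw') tensM volume_mul_ginj tmapE.
have [n [e [h [hh eh]]]] := dual_basis pR.
have [m [e' [h' [hh' eh']]]] := dual_basis pS.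
pose e_ a := hcomp hG p (e a); pose e'_ b := hcomp hH q (e' b).
(* The dual bases, cut down to degrees p and q, expand f (w (x) w'). *)
have [g g1 g2] : P (fun w w' => \sum_(a < n) \sum_(b < m)
    f (gtens (e_ a) (e'_ b)) * tens (h a w) (h' b w')).
  by apply: (P_sum) => a; apply: (P_sum) => b; apply: P_tens.
exists g => // p' q' w w' pq Gw Hw'; rewrite (g2 _ _ _ _ pq Gw Hw').
case: eqP => [p'p|_]; last by rewrite !scale0r.
move: pq Gw; rewrite p'p => /addnI q'q Gw; rewrite q'q in Hw'.
congr (_ *: (_ * ginj _ _ _)).
have wE : w = \sum_(a < n) e_ a * injR (h a w).
  rewrite -{1}(hcomp_id hG Gw) {1}(eh w) linear_sum; apply: eq_bigr => a _ /=.
  by rewrite hcomp_mulr0//; exact: calc_inj_deg.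
have w'E : w' = \sum_(b < m) e'_ b * injS (h' b w').
  rewrite -{1}(hcomp_id hH Hw') {1}(eh' w') linear_sum; apply: eq_bigr => b _ /=.
  by rewrite hcomp_mulr0//; exact: calc_inj_deg.
have -> : gtens w w' = \sum_(a < n) \sum_(b < m)
    gtens (e_ a) (e'_ b) * ginj OR OS (tens (h a w) (h' b w')).
  rewrite {1}wE {1}w'E [LHS]tens_suml; apply: eq_bigr => a _.
  rewrite [LHS]tens_sumr; apply: eq_bigr => b _.
  by rewrite ginjE (gtensM hG hH _ _ (calc_inj_deg _ _) (hcomp_deg hH q (e' b))) muln0 scale1r.
rewrite (right_linear_sum hf); apply: eq_bigr => a _.
rewrite (right_linear_sum hf); apply: eq_bigr => b _.
by rewrite [RHS](right_linearM hf).
Qed.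

Lemma integrable_tensor : fg_projective_right OR -> fg_projective_right OS ->
  @integrable_calculus _ _ TC (N + M) (gtens v v').
Proof.
move=> pR pS; apply/(integrable_calculusP volume_form_tensor) => k kNM; split.
  by move=> g gk; exact: perfect_tensor_inj.
move=> f hf; set n := (N + M - k)%N.
have kn : (k + n = N + M)%N by rewrite subnKC.
(* The component of bidegree (i, k - i) of the representing element; it is 0
   when i > N or k - i > M. *)
have /choice[g gP] (i : 'I_k.+1) : exists g, gdeg hG hH k g /\
    forall p q w w', (p + q = n)%N -> G p w -> H q w' ->
      g * gtens w w' = ((i + p)%N == N)%:R *: (gtens v v' * ginj OR OS (f (gtens w w'))).
  have ik : (i <= k)%N by rewrite -ltnS.
  have [iN|Ni] := leqP i N; last first.
    exists 0; split=> [|p q w w' _ _ _]; first exact: gdeg0.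
    by rewrite mul0r gtn_eqF ?scale0r// ltn_addr.
  have [jM|Mj] := leqP (k - i) M; last first.
    exists 0; split=> [|p q w w' pq _ _]; first exact: gdeg0.
    rewrite mul0r; case: eqP => [ipN|_]; last by rewrite scale0r.
    suff : (k - i <= M)%N by rewrite leqNgt Mj.
    have : (i + p + (k - i + q) = N + M)%N by rewrite addnACA subnKC// pq.
    by rewrite ipN => /addnI <-; exact: leq_addr.
  have [g gk gE] := perfect_tensor_bideg (subnKC iN) (subnKC jM) pR pS hf.
  exists g; split=> [|p q w w' pq Gw Hw']; first by rewrite -(subnKC ik).
  rewrite (gE _ _ _ _ _ Gw Hw'); last first.
    apply/(@addnI k); rewrite pq kn -[X in _ = (X + _)%N](subnKC ik) addnACA !subnKC//.
  by rewrite -[X in (i + p == X)%N](subnKC iN) eqn_add2l.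
exists (\sum_i g i) => [|y].
  by apply: (big_ind (gdeg hG hH k)) => [|x y|i _];
    [exact: gdeg0|exact: gdegD|exact: (gP i).1].
move: y; apply: gdeg_ind => [|x y ihx ihy|p q w w' pq Gw Hw'].
- by rewrite mulr0 (right_linear0 hf) linear0 mulr0.
- by rewrite mulrDr ihx ihy (right_linearD hf) linearD mulrDr.
rewrite mulr_suml; under eq_bigr do rewrite ((gP _).2 _ _ _ _ pq Gw Hw').
have [Np|pN] := ltnP N p.
  rewrite (degR_gt0 Gw Np) gtens0l (right_linear0 hf) !linear0 !mulr0.
  by rewrite big1// => i _; rewrite scaler0.
have [Mq|qM] := ltnP M q.
  rewrite (degS_gt0 Hw' Mq) gtens0r (right_linear0 hf) !linear0 !mulr0.
  by rewrite big1// => i _; rewrite scaler0.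
have Npk : (N - p < k.+1)%N.
  rewrite ltnS -(leq_add2r n) kn -pq addnA subnK//.
  by rewrite leq_add2l.
rewrite -scaler_suml (bigD1 (Ordinal Npk))//= subnK// eqxx big1 ?addr0 ?scale1r//.
move=> i iN; case: eqP => // ipN; case/eqP: iN; apply: val_inj => /=.
by rewrite -ipN addnK.
Qed.

End TopDegree.

End TensorCalculusTheory.

Theorem corollary3p2 (K : realType) (F : fieldType) (R S : algType F)
    (OR : calculus R) (OS : calculus S) :
  differentially_smooth_wrt OR K ->
  differentially_smooth_wrt OS K ->
  fg_projective_right OR ->
  fg_projective_right OS ->
  GKdim K (tensor R S) = (GKdim K R + GKdim K S)%E ->
  differentially_smooth (tensor R S) K.
Proof.
move=> [affR [N [gkR conR dimR [v hv intR]]]] [affS [M [gkS conS dimS [w hw intS]]]].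
move=> pR pS gk; exists (tensor_calculus OR OS); split; first exact: affine_tensor.
exists (N + M)%N; split.
- by rewrite gk gkR gkS natrD.
- exact: connected_tensor.
- exact: (dimension_tensor dimR dimS hv hw).
- exists (gtens (calc_graded OR) (calc_graded OS) v w).
    exact: volume_form_tensor.
  exact: integrable_tensor.
Qed.
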